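(* For every positive integer $D$ and every $\varepsilon>0$ there exists a constant $M$ such that the following holds. Let $G$ be a connected $D$-degenerate graph on vertex set $[n]$, let $R\sim G(n,\varepsilon/n)$ and $G^*=G\cup R$. Then asymptotically almost surely $T_{\mathrm{mix}}(G^* )\le M\log^2 n$.
   Context: $G(n,p)$ denotes the binomial random graph on $[n]$ with each pair an edge independently with probability $p$; $G\cup R$ is the graph on $[n]$ with edge set the union of those of $G$ and $R$. A graph is $D$-degenerate if every subgraph has a vertex of degree at most $D$. The lazy random walk on a connected graph $H=(V,E)$ is the Markov chain on $V$ which at a vertex $u$ stays put with probability $1/2$ and otherwise moves to a uniformly random neighbor of $u$; its stationary distribution is $\pi(u)=\deg(u)/(2|E|)$. With $P$ its transition matrix and $d_{TV}(p_1,p_2)=\max_{A\subseteq V}|p_1(A)-p_2(A)|$, the mixing time is $T_{\mathrm{mix}}(H)=\sup_{x_0}\min\{t : d_{TV}(x_0P^t,\pi)\le 1/4\}$, the supremum over all probability distributions $x_0$ on $V$. Asymptotically almost surely means with probability tending to $1$ as $n\to\infty$, for an arbitrary sequence of such graphs $G=G_n$. *)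

(* Defs.v *)
From Stdlib Require Import Reals ClassicalEpsilon.
From mathcomp Require Import all_boot.
Open Scope R_scope.
Set Implicit Arguments. Unset Strict Implicit. Unset Printing Implicit Defensive.

Definition pairs (n : nat) : {set {set 'I_n}} := [set e : {set 'I_n} | #|e| == 2%nat].

Definition is_graph n (E : {set {set 'I_n}}) : Prop := E \subset pairs n.

Definition adj n (E : {set {set 'I_n}}) : rel 'I_n := fun u v => [set u; v] \in E.

Definition connected n (E : {set {set 'I_n}}) : Prop :=
  forall u v : 'I_n, connect (adj E) u v.

Definition degenerate n (D : nat) (E : {set {set 'I_n}}) : Prop :=
  forall (W : {set 'I_n}) (F : {set {set 'I_n}}),
    W != set0 -> F \subset E -> (forall e, e \in F -> e \subset W) ->
    exists2 v, v \in W & (#|[set u | adj F v u]| <= D)%N.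

Definition deg n (E : {set {set 'I_n}}) (v : 'I_n) : nat := #|[set u | adj E v u]|.

Definition rsum (I : finType) (P : pred I) (f : I -> R) : R :=
  bigop.bigop 0 (index_enum I) (fun i => BigBody i Rplus (P i) (f i)).

Definition lazyP n (E : {set {set 'I_n}}) (u v : 'I_n) : R :=
  ((if u == v then / 2 else 0) +
   (if adj E u v then / (2 * INR (deg E u)) else 0)).

Definition step n (E : {set {set 'I_n}}) (x : 'I_n -> R) : 'I_n -> R :=
  fun v => rsum predT (fun u => (x u * lazyP E u v)).

Definition walk n (E : {set {set 'I_n}}) (t : nat) (x0 : 'I_n -> R) : 'I_n -> R :=
  iter t (step E) x0.

Definition stat n (E : {set {set 'I_n}}) (v : 'I_n) : R :=
  (INR (deg E v) / (2 * INR #|E|)).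

Definition is_distr n (x : 'I_n -> R) : Prop :=
  (forall v, 0 <= x v) /\ rsum predT x = 1.

Definition dTV_le n (p1 p2 : 'I_n -> R) (r : R) : Prop :=
  forall A : {set 'I_n},
    (Rabs (rsum (mem A) p1 - rsum (mem A) p2) <= r).

(* T_mix(H) <= b, where T_mix = sup_{x0} min{t : d_TV(x0 P^t, pi) <= 1/4}:
   for every initial distribution x0 the minimum exists and is <= b,
   i.e. some t <= b has d_TV(x0 P^t, pi) <= 1/4. *)
Definition Tmix_le n (E : {set {set 'I_n}}) (b : R) : Prop :=
  forall x0 : 'I_n -> R, is_distr x0 ->
    exists t : nat, (INR t <= b) /\ dTV_le (walk E t x0) (stat E) (/ 4).

Definition Gnp_prob (n : nat) (p : R) (A : {set {set 'I_n}} -> Prop) : R :=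
  rsum (mem (powerset (pairs n)))
    (fun S => if excluded_middle_informative (A S)
              then (p ^ #|S| * (1 - p) ^ (#|pairs n| - #|S|)%nat)
              else 0).

(* Main.v *)
(* Pass to levels of Green's function.  For a target set [B] carrying half of the volume
   and a start [x], the expected number of visits to [y] before hitting [B], divided by
   [deg y], is subharmonic off [x]; hence its superlevel sets are connected, contain [x],
   and are crossed by at most a unit flow.  Cauchy-Schwarz on each level bounds the expected
   hitting time of [B] by the sum over [y] of [deg y * profile (vol of the level of y)],
   which needs expansion of connected sets only.  This yields a Poincare inequality, and
   a maximal inequality for the lazy walk then turns hitting times into mixing time.

   A connected set [S] of [G*] either expands by a constant factor or has volume
   [O(log n)]: reveal the cluster of a root in a percolation that keeps the edges of [G]
   with probability close to 1 and opens a small proportion of the random edges.  The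
   events "the cluster is [S]" are disjoint, so the reciprocals of their probabilities
   bound the number of candidate sets [S] in the first-moment computation.  The hitting
   times are then [O(log^2 n)], the small sets and the dyadic volume scales contributing
   [log^2 n] and [log n] respectively. *)
Require Import Defs.
From Stdlib Require Import Reals ClassicalEpsilon.
From mathcomp Require Import all_boot all_order all_algebra.
From mathcomp Require Import Rstruct.
From mathcomp Require Import ring lra zify.
Set Implicit Arguments. Unset Strict Implicit. Unset Printing Implicit Defensive.
Import Order.TTheory GRing.Theory Num.Theory.

(** * The lazy walk in the weighted inner product *)

(** The vertices of [G] may have unbounded degree, so connected sets of a given size cannot be
    counted by powers of the maximum degree; this is what the percolation replaces, and degeneracy
    enters it through the bound [D * #|S|] on the edges of [G] inside [S]. Going from the Poincare
    inequality to mixing through the spectral gap alone would cost another factor [log n] from the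
    smallest stationary mass. This is avoided by asking for good behaviour only on half of the
    volume, at all times of a window, and letting a walk with a bad start hit that half first. Sets
    whose complement has few vertices escape the first-moment bound; such a complement carries at
    least half of the volume yet spans few edges, so much of its volume lies on the boundary. *)

Section LazyWalk.
Local Open Scope ring_scope.
Variables (R : realFieldType) (V : finType) (e : rel V).
Hypothesis e_sym : symmetric e.

Definition nbr (v : V) : nat := #|[set u | e v u]|.
Hypothesis nbr_gt0 : forall v, (0 < nbr v)%N.

Definition avg (f : V -> R) (x : V) : R :=
  f x / 2 + (\sum_(y | e x y) f y) / (2 * (nbr x)%:R).
Definition ip (f g : V -> R) : R := \sum_x (nbr x)%:R * f x * g x.
Definition energy (f : V -> R) : R := ip f f - ip (avg f) f.

Lemma nbrR_gt0 v : 0 < (nbr v)%:R :> R. Proof. by rewrite ltr0n. Qed.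

Lemma nbrR_neq0 v : (nbr v)%:R != 0 :> R. Proof. by rewrite gt_eqF ?nbrR_gt0. Qed.

Lemma sum_nbr_const (c : R) x : \sum_(y | e x y) c = (nbr x)%:R * c.
Proof. by rewrite sumr_const mulr_natl /nbr cardsE. Qed.

Lemma sum_edge_swap (F : V -> V -> R) :
  \sum_x \sum_(y | e x y) F x y = \sum_x \sum_(y | e x y) F y x.
Proof.
rewrite [LHS](exchange_big_dep predT) //=.
by apply: eq_bigr => y _; apply: eq_bigl => x; rewrite e_sym.
Qed.

Lemma eq_avg f g : f =1 g -> avg f =1 avg g.
Proof.
by move=> fg x; rewrite /avg fg; congr (_ + _ / _); apply: eq_bigr => y _; rewrite fg.
Qed.

Lemma eq_ip f f' g g' : f =1 f' -> g =1 g' -> ip f g = ip f' g'.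
Proof. by move=> ff gg; apply: eq_bigr => x _; rewrite ff gg. Qed.

Lemma avgB f g : avg (fun x => f x - g x) =1 (fun x => avg f x - avg g x).
Proof.
move=> x; rewrite /avg.
have -> : \sum_(y | e x y) (f y - g y) = \sum_(y | e x y) f y - \sum_(y | e x y) g y.
  by rewrite sumrB.
by field; exact: nbrR_neq0.
Qed.

Lemma avg_cst (c : R) : avg (fun=> c) =1 (fun=> c).
Proof.
by move=> x; rewrite /avg sum_nbr_const; field; exact: nbrR_neq0.
Qed.

Lemma avg_le f g x : (forall y, f y <= g y) -> avg f x <= avg g x.
Proof.
move=> fg; rewrite /avg lerD //; first by rewrite ler_pM2r ?fg ?invr_gt0.
by rewrite ler_pM2r ?ler_sum // invr_gt0 mulr_gt0 // nbrR_gt0.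
Qed.

Lemma norm_avg f x : `|avg f x| <= avg (fun y => `|f y|) x.
Proof.
rewrite /avg; apply: le_trans (ler_normD _ _) _; rewrite !normrM.
rewrite (ger0_norm (x := 2^-1)) ?invr_ge0 // (ger0_norm (x := _^-1)); last first.
  by rewrite invr_ge0 mulr_ge0.
by rewrite lerD // ler_wpM2r ?invr_ge0 ?mulr_ge0 // ler_norm_sum.
Qed.

Lemma avgDc (c : R) f x : avg (fun y => c + f y) x = c + avg f x.
Proof.
rewrite /avg big_split /= sum_nbr_const; field; exact: nbrR_neq0.
Qed.

Lemma avg_sum (I : Type) (r : seq I) (F : I -> V -> R) x :
  avg (fun y => \sum_(i <- r) F i y) x = \sum_(i <- r) avg (F i) x.
Proof.
rewrite /avg big_split /= -!mulr_suml; congr (_ + _ / _).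
exact: exchange_big.
Qed.

Lemma sub_avgE f x :
  (nbr x)%:R * (f x - avg f x) = (\sum_(y | e x y) (f x - f y)) / 2.
Proof.
rewrite sumrB sum_nbr_const /avg; field; exact: nbrR_neq0.
Qed.

Lemma ipC f g : ip f g = ip g f.
Proof. by apply: eq_bigr => x _; rewrite -!mulrA [f x * _]mulrC. Qed.

Lemma ip_ge0 f : 0 <= ip f f.
Proof. by apply: sumr_ge0 => x _; rewrite -mulrA mulr_ge0 // -expr2 sqr_ge0. Qed.

Lemma ipBl f g h : ip (fun x => f x - g x) h = ip f h - ip g h.
Proof. by rewrite /ip -sumrB; apply: eq_bigr => x _; rewrite mulrBr mulrBl. Qed.

Lemma ipBr f g h : ip h (fun x => f x - g x) = ip h f - ip h g.
Proof. by rewrite ipC ipBl !(ipC h). Qed.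

Lemma ip_avgE f g :
  ip (avg f) g = ip f g / 2 + (\sum_x \sum_(y | e x y) f y * g x) / 2.
Proof.
rewrite /ip !mulr_suml -big_split; apply: eq_bigr => x _ /=.
rewrite -mulr_suml /avg; field; exact: nbrR_neq0.
Qed.

Lemma avg_adj f g : ip (avg f) g = ip f (avg g).
Proof.
rewrite [RHS]ipC !ip_avgE [ip g f]ipC; congr (_ + _ / _).
by rewrite sum_edge_swap; apply: eq_bigr => x _; apply: eq_bigr => y _; rewrite mulrC.
Qed.

Lemma ip_avg1 f : ip (avg f) (fun=> 1) = ip f (fun=> 1).
Proof. by rewrite avg_adj; apply: eq_ip => // x; rewrite avg_cst. Qed.

Lemma energyE f :
  energy f = (\sum_x \sum_(y | e x y) (f x - f y) ^+ 2) / 4.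
Proof.
rewrite /energy ip_avgE.
have -> : \sum_x \sum_(y | e x y) (f x - f y) ^+ 2 =
   \sum_x \sum_(y | e x y) f x ^+ 2 + \sum_x \sum_(y | e x y) f y ^+ 2
   - 2 * \sum_x \sum_(y | e x y) f y * f x.
  rewrite mulr_sumr -big_split -sumrB /=; apply: eq_bigr => x _.
  rewrite mulr_sumr -big_split -sumrB /=; apply: eq_bigr => y _; ring.
rewrite (sum_edge_swap (fun x y => f y ^+ 2)) /=.
have -> : \sum_x \sum_(y | e x y) f x ^+ 2 = ip f f.
  by apply: eq_bigr => x _; rewrite sum_nbr_const expr2 mulrA.
by field.
Qed.

Lemma energy_ge0 f : 0 <= energy f.
Proof.
rewrite energyE divr_ge0 //; apply: sumr_ge0 => x _; apply: sumr_ge0 => y _.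
exact: sqr_ge0.
Qed.

Lemma sqr_sum_le (I : finType) (P : pred I) (f : I -> R) :
  (\sum_(i | P i) f i) ^+ 2 <= #|P|%:R * \sum_(i | P i) f i ^+ 2.
Proof.
set m := #|P|; set s := \sum_(i | P i) f i.
have : 0 <= \sum_(i | P i) (m%:R * f i - s) ^+ 2.
  by apply: sumr_ge0 => i _; apply: sqr_ge0.
have -> : \sum_(i | P i) (m%:R * f i - s) ^+ 2 =
    m%:R ^+ 2 * (\sum_(i | P i) f i ^+ 2) - 2 * m%:R * s * s + m%:R * s ^+ 2.
  have -> a : a * s = \sum_(i | P i) a * f i by rewrite mulr_sumr.
  rewrite mulr_sumr -sumrB.
  rewrite [X in _ = _ + X](_ : _ = \sum_(i | P i) s ^+ 2); last first.
    by rewrite sumr_const mulr_natl.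
  by rewrite -big_split; apply: eq_bigr => i _ /=; ring.
case: (posnP m) => [m0 _|m0].
  suff -> : s = 0 by rewrite m0 mul0r expr0n.
  by rewrite /s big_pred0 // => i; apply: (card0_eq m0).
have m0R : 0 < m%:R :> R by rewrite ltr0n.
rewrite (_ : _ + _ = m%:R * (m%:R * (\sum_(i | P i) f i ^+ 2) - s ^+ 2)); last by ring.
by rewrite pmulr_rge0 // subr_ge0.
Qed.

(* [avg = (id + Q) / 2] with [Q] an [ip]-contraction, so that
   [ip (avg f) (f - avg f)] is a quarter of [ip f f - ip (Q f) (Q f)]. *)
Lemma ip_avg_le f : ip (avg f) (avg f) <= ip (avg f) f.
Proof.
pose q x := (\sum_(y | e x y) f y) / (nbr x)%:R.
have avgq x : avg f x = (f x + q x) / 2.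
  by rewrite /avg /q; field; exact: nbrR_neq0.
rewrite -subr_ge0 -ipBr.
have -> : ip (avg f) (fun x => f x - avg f x) = (ip f f - ip q q) / 4.
  by rewrite /ip -sumrB mulr_suml; apply: eq_bigr => x _; rewrite avgq; field.
rewrite divr_ge0 // subr_ge0.
have -> : ip f f = \sum_x \sum_(y | e x y) f y ^+ 2.
  rewrite sum_edge_swap; apply: eq_bigr => x _.
  by rewrite sum_nbr_const expr2 mulrA.
apply: ler_sum => x _; rewrite /q.
have d0 := nbrR_gt0 x.
have := sqr_sum_le (e x) f.
rewrite (_ : #|e x| = nbr x); last by rewrite /nbr cardsE.
set s := \sum_(y | e x y) f y => sle.
rewrite (_ : _ * _ * _ = s ^+ 2 / (nbr x)%:R); last by field; exact: nbrR_neq0.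
by rewrite ler_pdivrMr // mulrC.
Qed.

Lemma ip_avg_ge0 f : 0 <= ip (avg f) f.
Proof. exact: le_trans (ip_ge0 _) (ip_avg_le f). Qed.

Lemma energy_le f : energy f <= ip f f - ip (avg f) (avg f).
Proof. by rewrite /energy lerB // ip_avg_le. Qed.

(** With [h = f - avg f], the two sides differ by exactly [ip (avg h) h], which laziness makes
    nonnegative. Summed over time, the squared increments of the walk are paid for by the energy. *)
Lemma energy_drop f :
  ip (fun x => f x - avg f x) (fun x => f x - avg f x) <= energy f - energy (avg f).
Proof.
rewrite -subr_ge0 (_ : _ - _ = ip (avg (fun x => f x - avg f x)) (fun x => f x - avg f x)).
  exact: ip_avg_ge0.
rewrite (eq_ip (avgB f (avg f)) (fun=> erefl)) /energy !ipBl !ipBr.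
rewrite (avg_adj (avg f) f) (ipC f (avg f)); ring.
Qed.

Section Maximal.
Variables (g : V -> R) (W : R).
Hypothesis W_gt0 : 0 < W.
Hypothesis poincare : forall f, ip f (fun=> 1) = 0 -> ip f f <= W * energy f.
Hypothesis g_mean0 : ip g (fun=> 1) = 0.
Let F t := iter t avg g.

Let F_mean0 t : ip (F t) (fun=> 1) = 0.
Proof. by elim: t => //= t IH; rewrite ip_avg1. Qed.

Let energy_anti s t : (s <= t)%N -> energy (F t) <= energy (F s).
Proof.
move=> /subnKC <-; elim: (t - s)%N => [|k IH]; rewrite ?addn0 ?addnS //=.
apply: le_trans IH; rewrite -subr_ge0; exact: le_trans (ip_ge0 _) (energy_drop _).
Qed.

Let sum_energy a k : \sum_(j < k) energy (F (a + j)) <= ip (F a) (F a).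
Proof.
suff : \sum_(j < k) energy (F (a + j)) <= ip (F a) (F a) - ip (F (a + k)) (F (a + k)).
  by move=> /le_trans -> //; rewrite gerBl ip_ge0.
elim: k => [|k IH]; first by rewrite big_ord0 addn0 subrr.
rewrite big_ord_recr /= addnS; have := energy_le (F (a + k)); move: IH => /=; lra.
Qed.

(** The energies decrease along the walk and sum to at most [ip g g]. *)
Lemma energy_iter_le t : t%:R * energy (F t) <= ip g g.
Proof.
apply: le_trans (sum_energy 0 t).
have -> : t%:R * energy (F t) = \sum_(j < t) energy (F t).
  by rewrite sumr_const card_ord mulr_natl.
by apply: ler_sum => j _; rewrite energy_anti // ltnW // add0n.
Qed.

Lemma ip_iter_le t : t%:R * ip (F t) (F t) <= W * ip g g.
Proof.
apply: (@le_trans _ _ (W * (t%:R * energy (F t)))); last first.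
  by rewrite ler_pM2l // energy_iter_le.
by rewrite mulrCA ler_wpM2l // poincare.
Qed.

(* The increments of [t |-> F t x ^+ 2] are split by AM-GM with weight [W]; summing them
   over [t >= t0] loses no logarithm because [energy_drop] telescopes and
   [energy (F t0)] is at most [ip g g / t0]. *)
Lemma maximal_ineq t0 N :
  exists2 U : V -> R,
    forall k x, (k <= N)%N -> (F (t0 + k) x) ^+ 2 <= U x &
    t0%:R * (\sum_x (nbr x)%:R * U x) <= 4 * W * ip g g.
Proof.
pose D j x := F (t0 + j) x - F (t0 + j).+1 x.
pose G j x := F (t0 + j) x ^+ 2 + F (t0 + j).+1 x ^+ 2.
pose C j x := W / 2 * D j x ^+ 2 + G j x / W.
exists (fun x => F t0 x ^+ 2 + \sum_(j < N) C j x) => [k x kN|].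
  have C_ge0 j : 0 <= C j x.
    have W0 := ltW W_gt0; apply: addr_ge0; first by rewrite mulr_ge0 ?sqr_ge0 ?divr_ge0.
    by rewrite divr_ge0 // addr_ge0 // sqr_ge0.
  apply: (@le_trans _ _ (F t0 x ^+ 2 + \sum_(j < k) C j x)).
    elim: k {kN} => [|k IH]; first by rewrite addn0 big_ord0 addr0.
    rewrite big_ord_recr /= addnS.
    suff : F (t0 + k).+1 x ^+ 2 <= F (t0 + k) x ^+ 2 + C k x by lra.
    rewrite /C /D /G; set a := F (t0 + k) x; set b := F _ x.
    have W0 : W != 0 by rewrite gt_eqF.
    have : 0 <= (W * (a - b) + (a + b)) ^+ 2 / (2 * W).
      by rewrite divr_ge0 ?sqr_ge0 // mulr_ge0 // ltW.
    have : 0 <= (a - b) ^+ 2 / (2 * W).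
      by rewrite divr_ge0 ?sqr_ge0 // mulr_ge0 // ltW.
    rewrite (_ : (W * (a - b) + (a + b)) ^+ 2 / (2 * W) =
       W / 2 * (a - b) ^+ 2 + (a ^+ 2 - b ^+ 2) + (a + b) ^+ 2 / (2 * W)); last by field.
    rewrite (_ : (a + b) ^+ 2 / (2 * W) = (a ^+ 2 + b ^+ 2) / W - (a - b) ^+ 2 / (2 * W));
      last by field.
    lra.
  rewrite lerD2l -(subnKC kN) big_split_ord /= lerDl.
  by apply: sumr_ge0 => j _; apply: C_ge0.
have sumU : \sum_x (nbr x)%:R * (F t0 x ^+ 2 + \sum_(j < N) C j x) =
    ip (F t0) (F t0) + W / 2 * (\sum_(j < N) ip (D j) (D j)) +
    (\sum_(j < N) (ip (F (t0 + j)) (F (t0 + j)) + ip (F (t0 + j).+1) (F (t0 + j).+1))) / W.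
  under eq_bigr do rewrite mulrDr.
  rewrite big_split /= -addrA; congr (_ + _).
    by apply: eq_bigr => x _; rewrite expr2 mulrA.
  under eq_bigr do rewrite mulr_sumr.
  rewrite exchange_big mulr_sumr mulr_suml -big_split; apply: eq_bigr => j _ /=.
  rewrite /ip -big_split /= mulr_sumr mulr_suml -big_split; apply: eq_bigr => x _ /=.
  by rewrite /C /G -[F (t0 + j).+1 x]/(avg (F (t0 + j)) x); field; rewrite gt_eqF.
rewrite sumU.
have sumD : \sum_(j < N) ip (D j) (D j) <= energy (F t0).
  apply: (@le_trans _ _ (energy (F t0) - energy (F (t0 + N)))); last first.
    by rewrite gerBl energy_ge0.
  elim: N {sumU} => [|N IH]; first by rewrite big_ord0 addn0 subrr.
  rewrite big_ord_recr /= addnS; have := energy_drop (F (t0 + N)).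
  rewrite -/(D N); move: IH => /=; lra.
have sumF : \sum_(j < N) (ip (F (t0 + j)) (F (t0 + j)) + ip (F (t0 + j).+1) (F (t0 + j).+1))
    <= 2 * W * ip (F t0) (F t0).
  apply: (@le_trans _ _ (2 * W * \sum_(j < N) energy (F (t0 + j)))); last first.
    by rewrite ler_pM2l ?mulr_gt0 // sum_energy.
  rewrite mulr_sumr; apply: ler_sum => j _.
  have := poincare (F_mean0 (t0 + j)); have := energy_le (F (t0 + j)).
  have := energy_ge0 (F (t0 + j)); move=> /=; lra.
have := energy_iter_le t0; have := ip_iter_le t0.
move: sumD sumF; set a := ip (F t0) _; set b := energy _; set c := ip g g.
set s1 := \sum_(j < N) _; set s2 := \sum_(j < N) _ => s1b s2a ta tb.
have : s2 / W <= 2 * a by rewrite ler_pdivrMr //; lra.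
set q := s2 / W => qa.
have t0_ge : 0 <= t0%:R :> R by [].
have c0 : 0 <= c by exact: ip_ge0.
have : W / 2 * s1 <= W / 2 * b by rewrite ler_pM2l // divr_gt0.
(* Multiplied by [t0], the part in [a] is at most [3 W c] and the part in [b] at most [W c / 2],
   together below [4 W c]. *)
move=> s1W; have : a + W / 2 * s1 + q <= 3 * a + W / 2 * b by lra.
set y := a + _ + _ => yle.
have : t0%:R * y <= t0%:R * (3 * a + W / 2 * b) by rewrite ler_wpM2l.
have : W * (t0%:R * b) <= W * c by rewrite ler_pM2l.
have : 0 <= W * c by rewrite mulr_ge0 // ltW.
lra.
Qed.

End Maximal.
End LazyWalk.

(** * Level sets of Green's function *)

Section Volume.
Local Open Scope nat_scope.
Variables (V : finType) (e : rel V).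
Definition vol (S : {set V}) : nat := \sum_(v in S) nbr e v.
Definition cut (S : {set V}) : nat :=
  #|[pred p : V * V | [&& p.1 \in S, p.2 \notin S & e p.1 p.2]]|.
Definition inside (S : {set V}) : rel V := [rel u v | [&& u \in S, v \in S & e u v]].
(** The root is explicit because it has a meaning on both sides: the start of the walk for level
    sets, the vertex whose cluster is revealed for percolation. *)
Definition conn_in (r : V) (S : {set V}) : bool :=
  (r \in S) && [forall (y | y \in S), connect (inside S) r y].

Lemma conn_inP r (S : {set V}) :
  reflect (r \in S /\ {in S, forall y, connect (inside S) r y}) (conn_in r S).
Proof. by apply: (iffP andP) => -[rS /forall_inP]. Qed.

Lemma vol_sub (S T : {set V}) : S \subset T -> vol S <= vol T.
Proof.
move=> sST; rewrite /vol [X in _ <= X](big_setID S) /= (setIidPr sST).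
exact: leq_addr.
Qed.

Lemma volC (S : {set V}) : vol S + vol (~: S) = vol [set: V].
Proof. by rewrite /vol [RHS](big_setID S) /= setTI setTD. Qed.
End Volume.

Section LevelSets.
Local Open Scope ring_scope.
Variables (R : realFieldType) (V : finType) (e : rel V).
Hypothesis e_sym : symmetric e.
Hypothesis nbr_gt0 : forall v, (0 < nbr e v)%N.
Hypothesis e_conn : forall u v, connect e u v.
Notation d v := ((nbr e v)%:R : R).

Lemma volE (S : {set V}) : (vol e S)%:R = \sum_(v in S) d v.
Proof. by rewrite /vol natr_sum. Qed.

(** Discrete divergence theorem: the two orientations of an edge inside [S] cancel. The factor [1/2]
    comes from laziness. *)
Lemma flow_out (g : V -> R) (S : {set V}) :
  \sum_(y in S) d y * (g y - avg e g y) =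
  (\sum_(y in S) \sum_(z | e y z && (z \notin S)) (g y - g z)) / 2.
Proof.
under eq_bigr => y _ do rewrite (sub_avgE nbr_gt0) (bigID (fun z => z \in S)) /= mulrDl.
rewrite big_split /= mulr_suml.
suff -> : \sum_(y in S) (\sum_(z | e y z && (z \in S)) (g y - g z)) / 2 = 0 by rewrite add0r.
rewrite -mulr_suml; set s := \sum_(y in S) _.
suff sN : s = - s by rewrite (_ : s = 0) ?mul0r //; lra.
rewrite {1}/s (exchange_big_dep (mem S)) /=; last by move=> y z _ /andP[].
rewrite /s -sumrN; apply: eq_bigr => z zS; rewrite -sumrN; apply: eq_big => [y|y _].
  by rewrite e_sym zS andbT andbC.
by rewrite opprB.
Qed.

Lemma exists_cut_edge (S : {set V}) x z :
  x \in S -> z \notin S -> exists u v, [/\ u \in S, v \notin S & e u v].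
Proof.
move=> xS zS; have /connectP[p ep zp] := e_conn x z.
elim: p x xS ep zp => [|v p IH] x xS /=; first by move=> _ zx; rewrite zx xS in zS.
case/andP=> exv ep zl; have [vS|vS] := boolP (v \in S); first exact: IH vS ep zl.
by exists x, v.
Qed.

Section Superlevel.
Variables (g : V -> R) (x : V).
Hypothesis g_ge0 : forall y, 0 <= g y.
Hypothesis g_sub : forall y, 0 < g y -> d y * (g y - avg e g y) <= (y == x)%:R.
Hypothesis g_zero : exists z, g z = 0.
Let S c := [set y | c < g y].

(* Off [x], [g] is subharmonic, so a component of [S c] avoiding [x] would have
   nonpositive outgoing flow, whereas [g] strictly drops along each of its boundary edges. *)
Lemma superlevel_conn c : 0 <= c -> S c != set0 -> conn_in e x (S c).
Proof.
move=> c0 Sn0; pose eS := inside e (S c).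
have gS y : y \in S c -> 0 < g y by rewrite inE; apply: le_lt_trans.
suff C0 : [set y in S c | ~~ ((x \in S c) && connect eS x y)] = set0.
  have {}C0 y : y \in S c -> (x \in S c) && connect eS x y.
    by move=> yS; have := in_set0 y; rewrite -C0 inE yS /= => /negbFE.
  case/set0Pn: Sn0 => y0 y0S; have /andP[xS _] := C0 _ y0S.
  by apply/conn_inP; split=> // y /C0 /andP[].
set C := [set y in _ | _].
have CS y : y \in C -> y \in S c by rewrite inE => /andP[].
have bd y z : y \in C -> e y z -> z \notin C -> z \notin S c.
  rewrite !inE => /andP[yS nc] eyz; apply: contra => zS.
  rewrite zS /=; apply: contra nc => /andP[-> xz] /=.
  by apply: connect_trans xz (connect1 _); rewrite /eS /inside /= !inE zS yS e_sym.
apply/eqP; apply: contraT => /set0Pn[y0 y0C].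
have : \sum_(y in C) d y * (g y - avg e g y) <= 0.
  apply: sumr_le0 => y yC; have /g_sub := gS _ (CS _ yC).
  have [yx|//] := eqVneq y x; move: yC; rewrite inE yx => /andP[xS].
  by rewrite xS connect0.
rewrite flow_out; case: g_zero => z0 gz0.
have z0C : z0 \notin C by apply: contraTN isT => /CS/gS; rewrite gz0 ltxx.
have [u [v [uC vC euv]]] := exists_cut_edge y0C z0C.
have pos y z : y \in C -> e y z && (z \notin C) -> 0 < g y - g z.
  move=> yC /andP[eyz zC]; have := bd _ _ yC eyz zC; rewrite inE -leNgt => gz.
  by have := CS _ yC; rewrite inE subr_gt0; apply: le_lt_trans.
rewrite leNgt divr_gt0 //; rewrite (bigD1 u) //= ltr_pwDl //.
  rewrite (bigD1 v) ?euv //= ltr_pwDl ?pos ?euv //.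
  by apply: sumr_ge0 => z /andP[ez _]; apply/ltW/pos.
by apply: sumr_ge0 => y /andP[yC _]; apply: sumr_ge0 => z ez; apply/ltW/pos.
Qed.

(** By [flow_out] the flow is twice the total source in the level set, and the only positive source
    is at most a unit at [x]. *)
Lemma superlevel_flow c : 0 <= c ->
  \sum_(p : V * V | [&& p.1 \in S c, p.2 \notin S c & e p.1 p.2]) (g p.1 - g p.2) <= 2.
Proof.
move=> c0.
rewrite -(pair_big_dep (fun y => y \in S c) (fun y z => (z \notin S c) && e y z)
            (fun y z => g y - g z)) /=.
rewrite (_ : \sum_(y | _) _ = 2 * \sum_(y in S c) d y * (g y - avg e g y)); last first.
  rewrite flow_out mulrC divfK ?pnatr_eq0 //.
  by apply: eq_bigr => y _; apply: eq_bigl => z; rewrite andbC.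
rewrite -[leRHS]mulr1 ler_pM2l //.
apply: (@le_trans _ _ (\sum_(y in S c) (y == x)%:R)).
  by apply: ler_sum => y; rewrite inE => cy; apply: g_sub; apply: le_lt_trans cy.
have [xS|xS] := boolP (x \in S c); last first.
  rewrite big1 // => y yS; case: eqP => // yx; by rewrite -yx yS in xS.
rewrite (bigD1 x) //= eqxx big1 ?addr0 // => y /andP[_ /negPf->] //.
Qed.

Variables (K k0 : nat).
Hypothesis g_half : (2 * vol e (S 0%R) <= vol e [set: V])%N.
Hypothesis expan : forall r T, conn_in e r T -> (2 * vol e T <= vol e [set: V])%N ->
  (vol e T <= K * cut e T)%N \/ (vol e T <= k0)%N.

(** Bounds [vol / cut ^ 2] for a level set of volume [p]: up to volume [k0] the boundary may only be
    known to be nonempty, which gives [k0]; an expanding set has [cut >= vol / K], which gives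
    [K ^ 2 / p]. *)
Definition profile (p : nat) : R := (if (p <= k0)%N then k0%:R else 0) + K%:R ^+ 2 / p%:R.
Definition lvl (y : V) : nat := vol e [set z | g y <= g z].

Lemma profile_anti p q : (0 < p)%N -> (p <= q)%N -> profile q <= profile p.
Proof.
move=> p0 pq; rewrite /profile lerD //.
  by case: ifP => [qk|_]; [rewrite (leq_trans pq qk)|case: ifP].
rewrite ler_wpM2l ?sqr_ge0 // lef_pV2 ?posrE ?ltr0n ?ler_nat //.
exact: leq_trans pq.
Qed.

Lemma profile_ge0 p : 0 <= profile p.
Proof.
by rewrite /profile addr_ge0 ?divr_ge0 ?sqr_ge0 //; case: ifP.
Qed.

Lemma vol_gt0 (T : {set V}) y : y \in T -> (0 < vol e T)%N.
Proof. by move=> yT; rewrite /vol (bigD1 y) //= addn_gt0 nbr_gt0. Qed.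

(* Cauchy-Schwarz against the unit flow through the level [c]. *)
Lemma vol_superlevel c : 0 <= c -> S c != set0 ->
  (vol e (S c))%:R <= 2 * profile (vol e (S c)) *
    \sum_(p : V * V | [&& p.1 \in S c, p.2 \notin S c & e p.1 p.2]) (g p.1 - g p.2)^-1.
Proof.
move=> c0 Sn0; pose Cr p := [&& p.1 \in S c, p.2 \notin S c & e p.1 p.2].
set T := \sum_(p | _) _.
have cS : conn_in e x (S c) by apply: superlevel_conn.
have [xS _] := conn_inP _ _ _ cS.
pose q : R := (cut e (S c))%:R.
have qT : q ^+ 2 <= 2 * T.
  have Cgt p : Cr p -> 0 < g p.1 - g p.2.
    case/and3P; rewrite !inE -leNgt => c1 c2 _; rewrite subr_gt0; exact: le_lt_trans c1.
  (* Cauchy-Schwarz in tangent form: [q - q^2 a / 4 <= 1 / a] for each gap [a]. The [q] gaps add up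
     to at most 2, so summation gives [q^2 / 2 <= T]. *)
  have : \sum_(p : V * V | Cr p) (q - q ^+ 2 / 4 * (g p.1 - g p.2)) <= T.
    apply: ler_sum => p /Cgt; move: (g p.1 - g p.2) => a a0.
    rewrite -subr_ge0 (_ : _ - _ = (1 - q * a / 2) ^+ 2 / a).
      by rewrite divr_ge0 ?sqr_ge0 ?ltW.
    by field; rewrite gt_eqF.
  rewrite sumrB -mulr_sumr sumr_const -[q *+ _]mulr_natl -/q.
  have : q ^+ 2 / 4 * (\sum_(p : V * V | Cr p) (g p.1 - g p.2)) <= q ^+ 2 / 4 * 2.
    by rewrite ler_wpM2l ?divr_ge0 ?sqr_ge0 // superlevel_flow.
  lra.
have cut1 : (0 < cut e (S c))%N.
  case: g_zero => z gz; have zS : z \notin S c by rewrite inE gz -leNgt.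
  have [u [v [uS vS euv]]] := exists_cut_edge xS zS.
  by apply/card_gt0P; exists (u, v); rewrite !inE /= in uS vS *; rewrite uS vS euv.
have q1 : 1 <= q by rewrite ler1n.
have v0 : 0 < (vol e (S c))%:R :> R by rewrite ltr0n (vol_gt0 xS).
suff volq : (vol e (S c))%:R <= profile (vol e (S c)) * q ^+ 2.
  apply: le_trans volq _; rewrite [2 * _]mulrC -mulrA ler_wpM2l ?profile_ge0 //.
have Sle : (2 * vol e (S c) <= vol e [set: V])%N.
  apply: leq_trans g_half; rewrite leq_pmul2l // vol_sub //.
  by apply/subsetP => y; rewrite !inE; apply: le_lt_trans.
rewrite /profile; case: (expan cS Sle) => [|vk]; last first.
  rewrite vk mulrDl; apply: (@le_trans _ _ (k0%:R * q ^+ 2)).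
    by rewrite (@le_trans _ _ k0%:R) ?ler_nat // ler_peMr // exprn_ege1.
  by rewrite lerDl !mulr_ge0 ?sqr_ge0 ?invr_ge0.
rewrite -(ler_nat R) natrM -/q; move: v0; set v := (vol e (S c))%:R => v0 vKq.
rewrite mulrDl; apply: (@le_trans _ _ (K%:R ^+ 2 / v * q ^+ 2)); last first.
  by rewrite lerDr mulr_ge0 ?sqr_ge0 //; case: ifP.
rewrite mulrAC -exprMn ler_pdivlMr // -expr2.
by rewrite ler_sqr ?nnegrE ?mulr_ge0 ?(ltW v0) //; lra.
Qed.

(** All these vertices lie in the closed superlevel set of the lowest among them, and that set has
    volume at most [k]. *)
Lemma vol_lvl_le k : (vol e [set y | (0 < g y)%R && (lvl y <= k)%N] <= k)%N.
Proof.
set T := [set y | _]; have [->|/set0Pn[y1 y1T]] := eqVneq T set0.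
  by rewrite /vol big_set0.
case: (arg_minP g y1T) => y yT ymin.
apply: (@leq_trans (lvl y)); last by have : y \in T := yT; rewrite inE => /andP[].
by apply: vol_sub; apply/subsetP => z /ymin gz; rewrite inE.
Qed.

(** The vertices with [lvl] at most [k0] have total volume at most [k0], whence [k0 ^ 2]. The term
    [1 / lvl] is dominated by a dyadic sum in which each of the [J] scales contributes at most
    [2 K ^ 2]. *)
Lemma sum_profile J : (vol e [set: V] < 2 ^ J)%N ->
  \sum_(y | 0 < g y) d y * profile (lvl y) <= (k0 ^ 2 + 2 * K ^ 2 * J)%:R.
Proof.
move=> volJ; rewrite /profile.
under eq_bigr do rewrite mulrDr.
rewrite big_split natrD /= lerD //.
  rewrite (bigID (fun y => lvl y <= k0)%N) /= [X in _ + X]big1 ?addr0; last first.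
    by move=> y /andP[_ /negPf ->]; rewrite mulr0.
  rewrite (eq_bigr (fun y => d y * k0%:R)) => [|y /andP[_ ->]//].
  rewrite -mulr_suml natrX expr2 ler_wpM2r //.
  rewrite -natr_sum ler_nat.
  by apply: leq_trans (vol_lvl_le k0); rewrite /vol; under [leqRHS]eq_bigl do rewrite inE.
have lvl_gt0 y : (0 < lvl y)%N by apply: (@vol_gt0 _ y); rewrite inE.
have lvl_lt y : (lvl y < 2 ^ J)%N by apply: leq_ltn_trans volJ; apply: vol_sub; apply: subsetT.
have inv_lvl y : (lvl y)%:R^-1 <= \sum_(i < J | (lvl y <= 2 ^ i.+1)%N) (2 ^ i)%:R^-1 :> R.
  have jJ : (trunc_log 2 (lvl y) < J)%N.
    by rewrite -(ltn_exp2l (m := 2)) // (leq_ltn_trans _ (lvl_lt y)) ?trunc_logP.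
  rewrite (bigD1 (Ordinal jJ)) /=; last by rewrite ltnW ?trunc_log_ltn.
  rewrite (@le_trans _ _ (2 ^ trunc_log 2 (lvl y))%:R^-1) //.
    by rewrite lef_pV2 ?posrE ?ltr0n ?expn_gt0 // ler_nat trunc_logP.
  by rewrite lerDl; apply: sumr_ge0 => i _; rewrite invr_ge0.
apply: (@le_trans _ _ (\sum_(y | 0 < g y) \sum_(i < J | (lvl y <= 2 ^ i.+1)%N)
   (K%:R ^+ 2 / (2 ^ i)%:R) * d y)).
  apply: ler_sum => y _; rewrite -mulr_suml -mulr_sumr mulrC ler_wpM2r //.
  by rewrite ler_wpM2l ?sqr_ge0 // inv_lvl.
rewrite (exchange_big_dep predT) //=.
rewrite (_ : (2 * K ^ 2 * J)%:R = \sum_(i < J) (2 * K%:R ^+ 2)); last first.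
  by rewrite sumr_const card_ord natrM mulr_natr natrM natrX.
apply: ler_sum => i _; rewrite -mulr_sumr mulrAC ler_pdivrMr ?ltr0n ?expn_gt0 //.
rewrite [2 * _]mulrC -[leRHS]mulrA.
rewrite ler_wpM2l ?sqr_ge0 // -natrM -expnS -natr_sum ler_nat.
apply: leq_trans (vol_lvl_le (2 ^ i.+1)); rewrite /vol.
by under [leqRHS]eq_bigl do rewrite inE.
Qed.

Lemma min_step (a c0 c : R) : c0 <= c -> (c <= a) || (a <= c0) ->
  Num.min a c - Num.min a c0 = if c0 < a then c - c0 else 0.
Proof.
move=> c0c; have [/orP[ca|ac]|//] := boolP ((c <= a) || (a <= c0)).
  have [ca0|ac0] := ltP c0 a; first by rewrite !min_r // ltW.
  have -> : c = c0 by apply/le_anti; rewrite c0c (le_trans ca ac0).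
  by rewrite min_l // subrr.
by rewrite !min_l ?(le_trans ac) // subrr ltNge ac.
Qed.

(* Layer-cake summation over the levels of [g]: raising the cutoff from [c0] to the
   next value [c] adds [(c - c0) * vol (S c0)] on the left, while on the right each edge
   leaving [S c0] gains [(c - c0)] over its gap. *)
Lemma sum_superlevels (v : V) :
  \sum_y d y * Num.min (g y) (g v) <=
  \sum_(p : V * V | e p.1 p.2 && (g p.2 < g p.1))
    2 * profile (lvl p.1) * ((Num.min (g p.1) (g v) - Num.min (g p.2) (g v)) / (g p.1 - g p.2)).
Proof.
have [m] := ubnP #|[set y | g y < g v]|; elim: m => // m IH in v *; rewrite ltnS => vm.
have [gv0|gv0] := eqVneq (g v) 0.
  rewrite !big1 // => [p|y] _; rewrite gv0 !min_r ?subrr ?mul0r ?mulr0 //.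
have {}gv0 : 0 < g v by rewrite lt_neqAle eq_sym gv0 g_ge0.
case: g_zero => z0 gz0.
have z0v : g z0 < g v by rewrite gz0.
(* [g u] is the next value of [g] below [g v]: no vertex lies strictly between, so the cutoff rises
   across a single gap. *)
case: (arg_maxP (P := fun y => g y < g v) g z0v) => u uv umax.
have {}IH := IH u.
have /IH {IH} IH : (#|[set y | (g y < g u)%R]| < m)%N.
  apply: leq_trans vm; apply: proper_card; apply/properP; split.
    by apply/subsetP => y; rewrite !inE => /lt_trans -> //.
  by exists u; rewrite inE // ltxx.
have gap y : (g v <= g y) || (g y <= g u).
  by case: leP => //= /umax.
have uv' := ltW uv.
have Sn0 : S (g u) != set0 by apply/set0Pn; exists v; rewrite inE.
have := vol_superlevel (g_ge0 u) Sn0.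
set p0 := vol e (S (g u)); set T := \sum_(p | _) _ => volT.
have lhs : \sum_y d y * Num.min (g y) (g v) =
    \sum_y d y * Num.min (g y) (g u) + (g v - g u) * p0%:R.
  apply/eqP; rewrite addrC -subr_eq -sumrB volE mulr_sumr; apply/eqP.
  rewrite [RHS]big_mkcond; apply: eq_bigr => y _ /=.
  rewrite -mulrBr (min_step uv' (gap y)) inE.
  by case: ifP; rewrite ?mulr0 // mulrC.
apply: le_trans (_ : _ <= \sum_(p : V * V | e p.1 p.2 && (g p.2 < g p.1))
    2 * profile (lvl p.1) * ((Num.min (g p.1) (g u) - Num.min (g p.2) (g u)) / (g p.1 - g p.2)) +
    (g v - g u) * (2 * profile p0 * T)) _.
  by rewrite lhs lerD // ler_wpM2l ?subr_ge0.
rewrite /T 2!mulr_sumr -lerBrDl -sumrB [leRHS](bigID (fun p => (g u < g p.1) && (g p.2 <= g u))) /=.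
rewrite -[leLHS]addr0 lerD //.
  rewrite (eq_bigl (fun p : V * V => e p.1 p.2 && (g p.2 < g p.1) && ((g u < g p.1) && (g p.2 <= g u)))).
    apply: ler_sum => p /andP[/andP[_ g21] /andP[gu1 gu2]].
    rewrite -mulrBr -mulrBl [X in _ <= _ * (X / _)](_ : _ = g v - g u); last first.
      by have := min_step uv' (gap p.1); have := min_step uv' (gap p.2);
         rewrite gu1 (ltNge (g u) (g p.2)) gu2 /= => m2 m1; move: m1 m2; lra.
    rewrite [leLHS]mulrCA; apply: ler_wpM2r; first by rewrite divr_ge0 ?subr_ge0 // ltW.
    rewrite ler_pM2l // profile_anti ?(@vol_gt0 _ p.1) ?inE //.
    by apply: vol_sub; apply/subsetP => z; rewrite !inE; apply: lt_le_trans.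
  move=> p; rewrite !inE -leNgt; have [gu1|_] := ltP (g u) (g p.1); rewrite ?andbF //=.
  have [gu2|_] := leP (g p.2) (g u); rewrite ?andbF //= !andbT.
  by rewrite (le_lt_trans gu2 gu1) andbT.
apply: sumr_ge0 => p /andP[/andP[_ g21] gg].
rewrite -mulrBr -mulrBl; apply: mulr_ge0; first by rewrite mulr_ge0 ?profile_ge0.
apply: divr_ge0; last by rewrite subr_ge0 ltW.
have := min_step uv' (gap p.1); have := min_step uv' (gap p.2).
have gvu : 0 <= g v - g u by rewrite subr_ge0.
case: (ltP (g u) (g p.2)) => [gu2|_] m2; first by rewrite (lt_trans gu2 g21); lra.
by case: ifP => _; lra.
Qed.

(** At the cutoff [max g] the ratio on every edge in [sum_superlevels] is 1; what remains is
    [2 * profile (lvl y)] once per edge descending from [y], hence at most [d y] times. *)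
Lemma sum_green_le J : (vol e [set: V] < 2 ^ J)%N ->
  \sum_y d y * g y <= 2 * (k0 ^ 2 + 2 * K ^ 2 * J)%:R.
Proof.
move=> volJ; case: (arg_maxP (P := predT) g (i0 := x) isT) => v _ vmax'.
have vmax y : g y <= g v by apply: vmax'.
rewrite (eq_bigr (fun y => d y * Num.min (g y) (g v))); last first.
  by move=> y _; rewrite min_l // vmax.
apply: le_trans (sum_superlevels v) _.
apply: le_trans (_ : _ <= \sum_(p : V * V | e p.1 p.2 && (g p.2 < g p.1)) 2 * profile (lvl p.1)) _.
  apply: ler_sum => p /andP[_ g21]; rewrite !min_l ?vmax //.
  by rewrite divff ?mulr1 // gt_eqF // subr_gt0.
apply: le_trans (_ : _ <= \sum_(y | 0 < g y) \sum_(z | e y z) 2 * profile (lvl y)) _.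
  rewrite pair_big_dep /= [leRHS](bigID (fun p => g p.2 < g p.1)) /=.
  rewrite -[leLHS]addr0 lerD //; last first.
    by apply: sumr_ge0 => p _; rewrite mulr_ge0 ?profile_ge0.
  rewrite [leRHS](eq_bigl (fun p => e p.1 p.2 && (g p.2 < g p.1))) // => p.
  have [g21|] := ltP (g p.2) (g p.1); rewrite ?andbF // !andbT.
  by rewrite (le_lt_trans (g_ge0 _) g21).
apply: le_trans (_ : _ <= 2 * \sum_(y | 0 < g y) d y * profile (lvl y)) _.
  by rewrite mulr_sumr; apply: ler_sum => y _; rewrite sum_nbr_const mulrCA.
by rewrite ler_pM2l // sum_profile.
Qed.

End Superlevel.
End LevelSets.

(** * Hitting times and mixing *)

Section Killed.
Local Open Scope ring_scope.
Variables (R : realFieldType) (V : finType) (e : rel V).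
Hypothesis e_sym : symmetric e.
Hypothesis nbr_gt0 : forall v, (0 < nbr e v)%N.
Variable B : {set V}.
Notation d v := ((nbr e v)%:R : R).

Definition kill (f : V -> R) (y : V) : R := if y \in B then 0 else avg e f y.
Definition alive (y : V) : R := (y \notin B)%:R.
(** The probability that the walk from a given vertex avoids [B] at all times up to [t]; its sum
    over [t] is the expected hitting time. *)
Definition surv (t : nat) : V -> R := iter t kill alive.

Lemma kill_le f g x : (forall y, f y <= g y) -> kill f x <= kill g x.
Proof. by move=> fg; rewrite /kill; case: ifP => // _; apply: avg_le. Qed.

Lemma kill_ge0 f x : (forall y, 0 <= f y) -> 0 <= kill f x.
Proof.
move=> f0; rewrite /kill; case: ifP => // _.
by rewrite -(avg_cst nbr_gt0 0 x); apply: avg_le.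
Qed.

Lemma surv_ge0 t x : 0 <= surv t x.
Proof. by elim: t x => [|t IH] x; [exact: ler0n | exact: kill_ge0]. Qed.

Lemma surv_decr t x : surv t.+1 x <= surv t x.
Proof.
elim: t x => [|t IH] x; last exact: kill_le.
rewrite /= /kill /alive; case: ifP => //= xB.
apply: le_trans (_ : _ <= avg e (fun=> 1) x) _; last by rewrite avg_cst.
by apply: avg_le => // y; case: (y \in B).
Qed.

Lemma surv_anti s t x : (s <= t)%N -> surv t x <= surv s x.
Proof.
move=> /subnKC <-; elim: (t - s)%N => [|k IH]; rewrite ?addn0 ?addnS //.
exact: le_trans (surv_decr _ _) IH.
Qed.

Lemma surv_in t x : x \in B -> surv t x = 0.
Proof. by case: t => [|t] xB; rewrite /surv /= /kill /alive xB. Qed.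

Lemma surv_le_sum T x : T%:R * surv T x <= \sum_(t < T) surv t x.
Proof.
have -> : T%:R * surv T x = \sum_(t < T) surv T x by rewrite sumr_const card_ord mulr_natl.
by apply: ler_sum => t _; rewrite surv_anti // ltnW.
Qed.

(** Strong Markov property at the first visit to [B], unrolled as an induction. A walk that hits [B]
    at step [j <= k] still has [t0 + k - j] steps to go, so the bound on [B] is needed at all times
    of the window. *)
Lemma iter_avg_hit (g : V -> R) (eta : R) (t0 N : nat) :
  0 <= eta -> (forall x, `|iter t0 (avg e) g x| <= 1) ->
  (forall t y, (t <= N)%N -> y \in B -> `|iter (t0 + t) (avg e) g y| <= eta) ->
  forall k x, (k <= N)%N -> `|iter (t0 + k) (avg e) g x| <= eta + surv k x.
Proof.
move=> eta0 g1 gB; elim=> [|k IH] x kN.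
  have [xB|xB] := boolP (x \in B); first by rewrite surv_in // addr0 gB.
  by rewrite addn0 /surv /= /alive xB; have := g1 x; rewrite /= ; lra.
have [xB|xB] := boolP (x \in B); first by rewrite surv_in // addr0 gB.
rewrite addnS /= [kill _ _]/kill (negPf xB).
apply: le_trans (norm_avg _ _ _) _; rewrite -avgDc //.
by apply: avg_le => // y; apply: IH; apply: ltnW.
Qed.

Section Green.
Variable x : V.
Let phi0 (y : V) : R := if y \in B then 0 else (y == x)%:R / d x.
Let phi t := iter t kill phi0.
(** Cut off at time [T] so that no infinite sum occurs; the cutoff only drops the nonnegative
    [phi T] in [green_sub]. By reversibility [phi t y] is the probability that the walk from [x],
    killed on [B], is at [y] at time [t], divided by [d y]. *)
Definition green (T : nat) (y : V) : R := \sum_(t < T) phi t y.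

Let phi_in t y : y \in B -> phi t y = 0.
Proof. by case: t => [|t] yB; rewrite /phi /= /kill /phi0 yB. Qed.

Let phi_ge0 t y : 0 <= phi t y.
Proof.
elim: t y => [|t IH] y; last exact: kill_ge0.
by rewrite /phi /= /phi0; case: ifP => // _; rewrite divr_ge0.
Qed.

Lemma green_ge0 T y : 0 <= green T y.
Proof. by apply: sumr_ge0. Qed.

Lemma green_in T y : y \in B -> green T y = 0.
Proof. by move=> yB; apply: big1 => t _; apply: phi_in. Qed.

Lemma green_sub T y : y \notin B -> d y * (green T y - avg e (green T) y) <= (y == x)%:R.
Proof.
move=> yB; rewrite avg_sum -sumrB.
have -> : \sum_(t < T) (phi t y - avg e (phi t) y) = phi 0 y - phi T y.
  elim: T => [|T IH]; first by rewrite big_ord0 subrr.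
  have phiS : phi T.+1 y = avg e (phi T) y.
    by rewrite -[LHS]/(kill (phi T) y) /kill (negPf yB).
  have cancel (a b c : R) : a - b + (b - c) = a - c by ring.
  by rewrite big_ord_recr IH phiS; apply: cancel.
apply: le_trans (_ : _ <= d y * phi 0 y) _; first by rewrite ler_wpM2l // gerBl.
rewrite /phi /= /phi0 (negPf yB); case: eqP => [->|_]; last by rewrite mul0r mulr0.
by rewrite mul1r divff // nbrR_neq0.
Qed.

Let kill_adj (f h : V -> R) : (forall y, y \in B -> f y = 0) ->
  (forall y, y \in B -> h y = 0) -> ip e (kill f) h = ip e f (kill h).
Proof.
move=> f0 h0; transitivity (ip e (avg e f) h).
  apply: eq_bigr => y _; rewrite /kill; case: ifP => // /h0 ->; by rewrite !mulr0.
rewrite avg_adj //; apply: eq_bigr => y _; rewrite /kill; case: ifP => // /f0 ->.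
by rewrite mulr0 !mul0r.
Qed.

(** The killed walk is self-adjoint, so its [t] steps can be moved from the point mass at [x] onto
    [alive]. *)
Lemma sum_green T : x \notin B -> \sum_y d y * green T y = \sum_(t < T) surv t x.
Proof.
move=> xB; under eq_bigr do rewrite mulr_sumr.
rewrite exchange_big; apply: eq_bigr => t _ /=.
transitivity (ip e (phi t) alive).
  apply: eq_bigr => y _; rewrite /alive; have [yB|yB] := boolP (y \in B).
    by rewrite phi_in // !mulr0.
  by rewrite mulr1.
have kill_in f y : y \in B -> kill f y = 0 by rewrite /kill => ->.
have swap s f h : (forall y, y \in B -> f y = 0) -> (forall y, y \in B -> h y = 0) ->
    ip e (iter s kill f) h = ip e f (iter s kill h).
  elim: s f h => //= s IH f h f0 h0; rewrite kill_adj //; last first.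
    by case: s {IH} => //= s y; apply: kill_in.
  by rewrite IH // -?iterSr // => y; apply: kill_in.
rewrite swap; last 2 first.
- by move=> y yB; rewrite /phi0 yB.
- by move=> y yB; rewrite /alive yB.
rewrite /ip (bigD1 x) //= big1 => [|y /negPf yx].
  by rewrite /phi0 (negPf xB) eqxx addr0 mul1r divff ?mul1r // nbrR_neq0.
by rewrite /phi0 yx mul0r; case: ifP; rewrite mulr0 mul0r.
Qed.

End Green.
End Killed.

(** * Poincare inequality and mixing from hitting times *)

Section Mixing.
Local Open Scope ring_scope.
Variables (R : realFieldType) (V : finType) (e : rel V).
Hypothesis e_sym : symmetric e.
Hypothesis nbr_gt0 : forall v, (0 < nbr e v)%N.
Hypothesis e_conn : forall u v, connect e u v.
Notation d v := ((nbr e v)%:R : R).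
Variables (K k0 J W : nat).
Hypothesis expan : forall r T, conn_in e r T -> (2 * vol e T <= vol e [set: V])%N ->
  (vol e T <= K * cut e T)%N \/ (vol e T <= k0)%N.
Hypothesis volJ : (vol e [set: V] < 2 ^ J)%N.
Hypothesis W_ge : (2 * (k0 ^ 2 + 2 * K ^ 2 * J) <= W)%N.
Hypothesis W_gt0 : (0 < W)%N.

Lemma sum_surv_le (B : {set V}) T x : (vol e [set: V] <= 2 * vol e B)%N ->
  \sum_(t < T) surv R e B t x <= W%:R.
Proof.
move=> Bhalf; have [xB|xB] := boolP (x \in B).
  by rewrite big1 // => t _; rewrite surv_in.
rewrite -sum_green //.
apply: le_trans (_ : _ <= (2 * (k0 ^ 2 + 2 * K ^ 2 * J))%:R) _; last by rewrite ler_nat.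
rewrite natrM; apply: (@sum_green_le _ _ _ e_sym nbr_gt0 e_conn _ x) expan _ volJ.
- exact: green_ge0.
- by move=> y; have [/green_in->|yB _] := boolP (y \in B); rewrite ?ltxx // green_sub.
- have /set0Pn[z zB] : B != set0.
    apply: contraTneq Bhalf => ->; rewrite /vol big_set0 muln0 -ltnNge.
    by rewrite (bigD1 x) //= addn_gt0 nbr_gt0.
  by exists z; apply: green_in.
have sub : [set y | (0 < green R e B x T y)%R] \subset ~: B.
  by apply/subsetP => y; rewrite !inE; apply: contraTN => /green_in ->; rewrite ltxx.
rewrite (leq_trans (leq_mul (leqnn 2) (vol_sub e sub))) //.
by have := volC e B; move: Bhalf; lia.
Qed.

(* Barta's argument: write [f = a * w] with [w] a truncated expected hitting time of [B],
   which satisfies [w - avg w >= 1/2] off [B]. *)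
Lemma dirichlet_le (B : {set V}) (f : V -> R) : (vol e [set: V] <= 2 * vol e B)%N ->
  (forall y, y \in B -> f y = 0) -> ip e f f <= 2 * W%:R * energy e f.
Proof.
(* Off [B], [w - avg w] equals [1 - surv T], and Markov's inequality gives
   [surv T <= W / T = 1/2]. *)
move=> Bhalf f0; pose T := (2 * W)%N.
pose w y : R := \sum_(t < T) surv R e B t y.
have w_le y : w y <= W%:R by apply: sum_surv_le.
have w_ge0 y : 0 <= w y by apply: sumr_ge0 => t _; apply: surv_ge0.
have WR : 0 < W%:R :> R by rewrite ltr0n.
have w_sub y : y \notin B -> 1 / 2 <= w y - avg e w y.
  move=> yB; rewrite avg_sum -sumrB.
  have -> : \sum_(t < T) (surv R e B t y - avg e (surv R e B t) y) = 1 - surv R e B T y.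
    have <- : surv R e B 0%N y = 1 by rewrite /surv /= /alive yB.
    elim: T {w w_le w_ge0} => [|T IH]; first by rewrite big_ord0 subrr.
    have survS : surv R e B T.+1 y = avg e (surv R e B T) y.
      by rewrite -[LHS]/(kill e B (surv R e B T) y) /kill (negPf yB).
    have cancel (a b c : R) : a - b + (b - c) = a - c by ring.
    by rewrite big_ord_recr IH survS; apply: cancel.
  have := surv_le_sum R nbr_gt0 B T y; rewrite -/(w y) natrM.
  have := w_le y; move: (w y) (surv _ _ _ _ _) => a s aW sa.
  have : W%:R * (2 * s) <= W%:R * 1 by rewrite mulr1; lra.
  by rewrite ler_pM2l //; lra.
have w_gt0 y : y \notin B -> 0 < w y.
  move=> /w_sub; have : 0 <= avg e w y by rewrite -(avg_cst nbr_gt0 0 y); apply: avg_le.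
  lra.
pose a y : R := if y \in B then 0 else f y / w y.
have fE y : f y = a y * w y.
  rewrite /a; case: ifP => [/f0->|/negbT yB]; first by rewrite mul0r.
  by rewrite divfK // gt_eqF ?w_gt0.
apply: le_trans (_ : _ <= 2 * W%:R * \sum_x d x * (a x ^+ 2 * w x * (w x - avg e w x))) _.
  rewrite mulr_sumr; apply: ler_sum => x _.
  have [xB|xB] := boolP (x \in B).
    by rewrite f0 // /a xB expr0n !mul0r !mulr0.
  rewrite fE -subr_ge0.
  have -> : 2 * W%:R * (d x * (a x ^+ 2 * w x * (w x - avg e w x))) - d x * (a x * w x) * (a x * w x)
     = d x * (a x ^+ 2 * w x * (2 * W%:R * (w x - avg e w x) - w x)) by ring.
  apply: mulr_ge0 => //; apply: mulr_ge0; first by rewrite mulr_ge0 ?sqr_ge0 ?w_ge0.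
  rewrite subr_ge0.
  apply: le_trans (w_le x) _.
  have : W%:R * (1 / 2) <= W%:R * (w x - avg e w x) by rewrite ler_pM2l // w_sub.
  lra.
rewrite ler_pM2l ?mulr_gt0 // energyE //.
have -> : \sum_x d x * (a x ^+ 2 * w x * (w x - avg e w x)) =
    (\sum_x \sum_(y | e x y) a x ^+ 2 * w x * (w x - w y)) / 2.
  rewrite mulr_suml; apply: eq_bigr => x _; rewrite mulrCA (sub_avgE nbr_gt0).
  by rewrite mulrA mulr_sumr.
rewrite [4](_ : _ = 2 * 2); last by ring.
rewrite invfM mulrA ler_pM2r ?invr_gt0 // ler_pdivlMr // mulrC mulr_natl mulr2n.
rewrite [X in X + _](sum_edge_swap e_sym) -big_split /=; apply: ler_sum => x _.
rewrite -big_split /=; apply: ler_sum => y _; rewrite !fE -subr_ge0.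
(* Ground-state identity for [f = a * w]: once the two orientations of an edge are paired, the
   deficit is a weighted square. *)
rewrite (_ : _ - _ = w x * w y * (a x - a y) ^+ 2); last by ring.
by rewrite mulr_ge0 ?sqr_ge0 ?mulr_ge0.
Qed.

(** [m] is the largest value of [f] whose superlevel set has half of the volume. The next larger
    value fails this, so the complement of its superlevel set, which is the sublevel set of [m], has
    half as well. *)
Lemma exists_median (f : V -> R) (v0 : V) : exists m,
  (vol e [set: V] <= 2 * vol e [set y | (m <= f y)%R])%N /\
  (vol e [set: V] <= 2 * vol e [set y | (f y <= m)%R])%N.
Proof.
pose P v := (vol e [set: V] <= 2 * vol e [set y | (f v <= f y)%R])%N.
have [v1 v1min] : exists v1, forall y, f v1 <= f y.
  by case: (arg_minP (P := predT) f (i0 := v0) isT) => v1 _ vmin; exists v1 => y; apply: vmin.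
have Pv1 : P v1.
  rewrite /P (_ : [set y | _] = setT) ?leq_pmull //.
  by apply/setP => y; rewrite !inE v1min.
case: (arg_maxP (P := P) f Pv1) => v Pv vmax; exists (f v); split => //.
have VC := volC e [set y | (f y <= f v)%R].
have [v2 v2S|v2] := pickP (mem (~: [set y | (f y <= f v)%R])); last first.
  move: VC; rewrite (_ : ~: _ = set0) => [|]; last by apply/setP => y; rewrite in_set0; apply: v2.
  by rewrite /vol big_set0; lia.
case: (arg_minP f v2S) => v3 v3v v3min.
have v3gt : f v < f v3 by have : v3 \in ~: [set y | (f y <= f v)%R] := v3v; rewrite !inE -ltNge.
have : ~~ P v3.
  apply/negP => /vmax v3le; have : f v3 <= f v := v3le; by rewrite leNgt v3gt.
rewrite /P -ltnNge (_ : [set y | (f v3 <= f y)%R] = ~: [set y | (f y <= f v)%R]).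
  by move: VC; lia.
apply/setP => y; rewrite !inE -ltNge; apply/idP/idP => [|yv]; first exact: lt_le_trans.
by apply: v3min; rewrite /= !inE -ltNge.
Qed.

(** The positive and negative parts of [f - m], for a median [m], each vanish on half of the volume,
    so [dirichlet_le] applies to both. Splitting does not increase the energy, and the mean-zero
    condition makes centring at [m] harmless. *)
Lemma poincare_le (f : V -> R) : ip e f (fun=> 1) = 0 -> ip e f f <= 2 * W%:R * energy e f.
Proof.
move=> f_mean0; have [v0 _|V0] := pickP (@predT V); last first.
  have sum0 (F : V -> R) : \sum_x F x = 0 by rewrite big_pred0.
  by rewrite /energy /ip !sum0 subrr mulr0.
have [m [Bq Bp]] := exists_median f v0.
pose p y := Num.max (f y - m) 0; pose q y := Num.max (m - f y) 0.
have pq y : (p y = f y - m /\ q y = 0) \/ (p y = 0 /\ q y = m - f y).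
  rewrite /p /q; have [fm|fm] := leP (f y) m.
    by right; rewrite max_r ?max_l // ?subr_ge0 // subr_le0.
  by left; rewrite max_l ?max_r // ?subr_ge0 ?subr_le0 ltW.
have p0 y : y \in [set y | (f y <= m)%R] -> p y = 0.
  by rewrite inE => fm; rewrite /p max_r // subr_le0.
have q0 y : y \in [set y | (m <= f y)%R] -> q y = 0.
  by rewrite inE => fm; rewrite /q max_r // subr_le0.
have := dirichlet_le Bp p0; have := dirichlet_le Bq q0.
have p_ge0 y : 0 <= p y by rewrite /p le_max lexx orbT.
have q_ge0 y : 0 <= q y by rewrite /q le_max lexx orbT.
have ff : ip e f f <= ip e p p + ip e q q.
  have -> : ip e p p + ip e q q = ip e f f - 2 * m * ip e f (fun=> 1) + \sum_x d x * m ^+ 2.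
    rewrite /ip mulr_sumr -sumrB -!big_split /=; apply: eq_bigr => x _.
    by case: (pq x) => -[-> ->]; ring.
  by rewrite f_mean0 mulr0 subr0 lerDl; apply: sumr_ge0 => x _; rewrite mulr_ge0 ?sqr_ge0.
have Ef : energy e p + energy e q <= energy e f.
  rewrite !energyE // -mulrDl ler_pM2r ?invr_gt0 // -big_split; apply: ler_sum => x _ /=.
  rewrite -big_split; apply: ler_sum => y _ /=.
  rewrite -subr_ge0.
  rewrite (_ : _ - _ = 2 * (p x * q y + p y * q x)); last first.
    by case: (pq x) (p_ge0 x) (q_ge0 x) => -[-> ->]; case: (pq y) => -[-> ->] _ _; ring.
  by rewrite mulr_ge0 // addr_ge0 // mulr_ge0.
have : 2 * W%:R * (energy e p + energy e q) <= 2 * W%:R * energy e f.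
  by rewrite ler_pM2l // mulr_gt0 // ltr0n.
lra.
Qed.

(* The set of [x] at which the walk from [x] has forgotten [A] at all times between [256 W]
   and [264 W] carries half of the volume by [maximal_ineq], and is hit within [8 W] steps
   with probability at least [7/8]. *)
Lemma lazy_walk_mixing (A : {set V}) (x : V) :
  `|iter (264 * W) (avg e) (fun y => (y \in A)%:R) x
     - (vol e A)%:R / (vol e [set: V])%:R| <= 1 / 4 :> R.
Proof.
set v : R := (vol e [set: V])%:R; set a : R := (vol e A)%:R.
have v0 : 0 < v by rewrite ltr0n /vol (bigD1 x) //= addn_gt0 nbr_gt0.
have a0 : 0 <= a by rewrite ler0n.
have av : a <= v by rewrite ler_nat vol_sub ?subsetT.
have WR : 0 < W%:R :> R by rewrite ltr0n.
pose g y : R := (y \in A)%:R - a / v.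
have iterE t y : iter t (avg e) g y = iter t (avg e) (fun y => (y \in A)%:R) y - a / v.
  elim: t y => // t IH y /=; rewrite (eq_avg e IH) (avgB nbr_gt0) (avg_cst nbr_gt0) //.
have vE : v = \sum_y d y by rewrite /v (volE R); apply: eq_bigl => y; rewrite inE.
have aE : a = \sum_y d y * (y \in A)%:R.
  rewrite /a (volE R) big_mkcond; apply: eq_bigr => y _.
  by case: (y \in A); rewrite ?mulr1 ?mulr0.
have g_mean0 : ip e g (fun=> 1) = 0.
  rewrite /ip (eq_bigr (fun y => d y * (y \in A)%:R - d y * (a / v))); last first.
    by move=> y _; rewrite /g; ring.
  by rewrite sumrB -mulr_suml -vE -aE mulrC divfK ?subrr // gt_eqF.
have gg : ip e g g <= v / 4.
  have -> : ip e g g = a - a ^+ 2 / v.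
    rewrite /ip (eq_bigr (fun y => (1 - 2 * (a / v)) * (d y * (y \in A)%:R) +
       (a / v) ^+ 2 * d y)); last first.
      by move=> y _; rewrite /g; case: (y \in A) => /=; ring.
    rewrite big_split /= -!mulr_sumr -vE -aE; field; rewrite gt_eqF //.
  rewrite -subr_ge0 (_ : _ - _ = (v - 2 * a) ^+ 2 / (4 * v)).
    by rewrite divr_ge0 ?sqr_ge0 // mulr_ge0 // ltW.
  by field; rewrite gt_eqF.
have W2 : 0 < 2 * W%:R :> R by rewrite mulr_gt0.
(* With Poincare constant [2 W] and [ip g g <= v / 4], time [256 W] makes the total of [U] at most
   [v / 128], so [U > 1/64 = (1/8)^2] on at most half of the volume. The window [8 W] makes the
   chance of missing the good half at most [1/8]. *)
have [U FU sumU] := maximal_ineq e_sym nbr_gt0 W2 (@poincare_le) g_mean0 (256 * W) (8 * W).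
pose B := [set y | (U y <= 1 / 64)%R].
have U_ge0 y : 0 <= U y by apply: le_trans (FU 0%N y (leq0n _)); apply: sqr_ge0.
have Bhalf : (vol e [set: V] <= 2 * vol e B)%N.
  suff : (2 * vol e (~: B) <= vol e [set: V])%N by have := volC e B; lia.
  rewrite -(ler_nat R) natrM (volE R e (~: B)) -/v.
  have : \sum_(y in ~: B) d y <= 64 * \sum_y d y * U y.
    rewrite mulr_sumr [leRHS](bigID (fun y => y \in ~: B)) /= -[leLHS]addr0 lerD //.
      apply: ler_sum => y; rewrite !inE -ltNge => Uy.
      have : d y * (1 / 64) <= d y * U y by rewrite ler_wpM2l // ltW.
      lra.
    by apply: sumr_ge0 => y _; rewrite mulr_ge0 // mulr_ge0.
  move: sumU; rewrite natrM -!mulrA; set s := \sum_y d y * U y; set b := \sum_(y in _) _.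
  move=> sW bs.
  have : W%:R * (256 * s) <= W%:R * (2 * v).
    have : W%:R * ip e g g <= W%:R * (v / 4) by rewrite ler_pM2l.
    lra.
  rewrite ler_pM2l //; lra.
have g1 t y : `|iter t (avg e) g y| <= 1.
  elim: t y => [|t IH] y /=.
    have : 0 <= a / v by rewrite divr_ge0 // ltW.
    have : a / v <= 1 by rewrite ler_pdivrMr // mul1r.
    by rewrite /g ler_norml; case: (y \in A) => /=; lra.
  apply: le_trans (norm_avg _ _ _) _; rewrite -[leRHS](avg_cst nbr_gt0 1 y).
  exact: avg_le.
have FB t y : (t <= 8 * W)%N -> y \in B -> `|iter (256 * W + t) (avg e) g y| <= 1 / 8.
  move=> tW; rewrite inE => Uy; have := le_trans (FU t y tW) Uy.
  rewrite -real_normK ?num_real // (_ : 1 / 64 = (1 / 8) ^+ 2); last by field.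
  by rewrite ler_sqr ?nnegrE ?normr_ge0 //; lra.
rewrite -iterE (_ : 264 * W = 256 * W + 8 * W)%N; last by lia.
have eta0 : 0 <= 1 / 8 :> R by lra.
apply: le_trans (@iter_avg_hit R V e nbr_gt0 B g _ _ _ eta0 (g1 _) FB _ x (leqnn _)) _.
have := surv_le_sum R nbr_gt0 B (8 * W) x; have := sum_surv_le (8 * W) x Bhalf.
set s := \sum_(t < _) _; rewrite natrM; set u := surv _ _ _ _ _ => sW us.
have : W%:R * (8 * u) <= W%:R * 1 by rewrite mulr1; lra.
by rewrite ler_pM2l //; lra.
Qed.

End Mixing.

(** * Edges inside and across vertex sets *)

Section GraphSets.
Local Open Scope nat_scope.
Variable n : nat.
Implicit Types (G F H : {set {set 'I_n}}) (S C : {set 'I_n}).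

Definition inner (S : {set 'I_n}) : {set {set 'I_n}} := [set t in pairs n | t \subset S].
Definition across (S : {set 'I_n}) : {set {set 'I_n}} :=
  [set t in pairs n | ~~ (t \subset S) && ~~ (t \subset ~: S)].
Definition touch (S : {set 'I_n}) : {set {set 'I_n}} := inner S :|: across S.

Lemma adj_sym G : symmetric (adj G).
Proof. by move=> u v; rewrite /adj setUC. Qed.

Lemma adj_mono G F u v : G \subset F -> adj G u v -> adj F u v.
Proof. by move=> /subsetP; apply. Qed.

Lemma adj_neq G u v : is_graph G -> adj G u v -> u != v.
Proof.
by move=> /subsetP gG /gG; rewrite inE cards2; case: (u != v).
Qed.

Lemma adj_inner G S u v : is_graph G -> adj G u v -> u \in S -> v \in S ->
  [set u; v] \in inner S.
Proof. by move=> /subsetP gG uv uS vS; rewrite inE gG // subUset !sub1set uS vS. Qed.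

Lemma pair_across (S : {set 'I_n}) u v : u \in S -> v \notin S -> [set u; v] \in across S.
Proof.
move=> uS vS; rewrite !inE !subUset !sub1set !inE uS (negPf vS) cards2.
by rewrite (_ : u != v) //; apply: contraNneq vS => <-.
Qed.

Lemma inner_across_disj S : [disjoint inner S & across S].
Proof.
rewrite disjoint_subset; apply/subsetP => t; rewrite !inE => /andP[-> tS].
by rewrite tS.
Qed.

Lemma card_touch S : #|touch S| <= #|S| * n.
Proof.
have sub : touch S \subset [set [set p.1; p.2] | p in setX S [set: 'I_n]].
  apply/subsetP => t tT.
  have /cards2P[u [v [uv tE]]] : #|t| == 2.
    by move: tT; rewrite !inE -andb_orr => /andP[].
  suff [uS|vS] : u \in S \/ v \in S.
  - by apply/imsetP; exists (u, v); rewrite ?inE ?uS.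
  - by apply/imsetP; exists (v, u); rewrite ?inE ?vS // tE setUC.
  have : ~~ (t \subset ~: S).
    move: tT; rewrite !inE => /orP[/andP[_ tS]|/andP[_ /andP[]]//].
    apply/negP => tC; have : u \in S :&: ~: S by rewrite inE (subsetP tS) ?(subsetP tC) // tE !inE eqxx.
    by rewrite setICr inE.
  by rewrite tE subUset !sub1set !inE negb_and !negbK => /orP.
apply: leq_trans (subset_leq_card sub) _; apply: leq_trans (leq_imset_card _ _) _.
by rewrite cardsX cardsT card_ord.
Qed.

Lemma card_across S : #|S| * #|~: S| <= #|across S|.
Proof.
rewrite -cardsX -(card_in_imset (f := fun p => [set p.1; p.2])).
  apply/subset_leq_card/subsetP => t /imsetP[[u v]]; rewrite !inE /= => /andP[uS vS] ->.
  by have := pair_across uS vS; rewrite !inE.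
move=> [u v] [u' v']; rewrite !inE /= => /andP[uS vS] /andP[uS' vS'] E.
have : u \in [set u'; v'] by rewrite -E !inE eqxx.
have : v \in [set u'; v'] by rewrite -E !inE eqxx orbT.
rewrite !inE => /orP[/eqP vE|/eqP->]; first by rewrite vE uS' in vS.
by move=> /orP[/eqP->//|/eqP uE]; rewrite -uE uS in vS'.
Qed.

(** Peeling off a vertex of degree at most [D] in the graph induced on [S] loses at most [D]
    edges. *)
Lemma degenerate_inner D G S : degenerate D G -> is_graph G ->
  #|G :&: inner S| <= D * #|S|.
Proof.
move=> dG gG; have [m] := ubnP #|S|; elim: m S => // m IH S; rewrite ltnS => Sm.
have [->|S0] := eqVneq S set0.
  rewrite cards0 muln0 leqn0 cards_eq0; apply/eqP/setP => t; rewrite !inE.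
  by apply/negP => /and3P[_ t2]; rewrite subset0 => /eqP t0; rewrite t0 cards0 in t2.
have [|v vS vD] := dG S (G :&: inner S) S0 (subsetIl _ _).
  by move=> t; rewrite !inE => /and3P[].
have Sv : #|S :\ v| < #|S| by rewrite (cardsD1 v S) vS.
have := IH (S :\ v) (leq_trans Sv Sm).
rewrite (cardsD1 v S) vS add1n mulnS; set Gv := G :&: inner (S :\ v) => GvD.
have sub : G :&: inner S \subset Gv :|: [set [set v; u] | u in [set u | adj (G :&: inner S) v u]].
  apply/subsetP => t tG; have [vt|vt] := boolP (v \in t).
    have /cards2P[a [b [ab tE]]] : #|t| == 2 by move: tG; rewrite !inE => /and3P[].
    rewrite inE; apply/orP; right; apply/imsetP.
    move: vt; rewrite tE !inE => /orP[/eqP va|/eqP vb].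
      by exists b; rewrite ?inE /adj va // -tE.
    by exists a; rewrite ?inE /adj vb setUC // -tE.
  rewrite inE; apply/orP; left; move: tG; rewrite !inE => /and3P[-> -> tS] /=.
  by rewrite subsetD1 tS vt.
apply: leq_trans (subset_leq_card sub) _; apply: leq_trans (leq_card_setU _ _) _.
rewrite addnC leq_add // (leq_trans (leq_imset_card _ _)) //.
Qed.

Lemma inside_sub_comp G S v y : v \in S -> connect (inside (adj G) S) v y -> y \in S.
Proof.
move=> vS /connectP[p pp ->]; elim: p v vS pp => //= w p IH v vS /andP[/and3P[_ wS _]].
exact: IH.
Qed.

Lemma connect_inside G F S C : G \subset F -> S \subset C ->
  subrel (connect (inside (adj G) S)) (connect (inside (adj F) C)).
Proof.
move=> GF SC; apply: connect_sub => u v /and3P[uS vS uv]; apply: connect1.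
by rewrite /inside /= !(subsetP SC) // (adj_mono GF).
Qed.

(* Each component of [G] inside [S], other than all of the vertex set, sends an edge of
   the connected graph [G] out of [S]; so at most [#|G :&: across S| - 1] additional edges
   are needed to join the components. *)
Lemma few_joining_edges G H r S : connected G -> is_graph G ->
  S != [set: 'I_n] -> conn_in (adj (G :|: H)) r S -> H \subset pairs n ->
  exists F : {set {set 'I_n}},
    [/\ F \subset H, F \subset inner S :\: G, #|F| <= #|G :&: across S| & conn_in (adj (G :|: F)) r S].
Proof.
move=> cG gG ST /conn_inP[rS rconn] gH.
pose comp v := [set y | connect (inside (adj G) S) v y].
(* [C] is a union of components of [G] inside [S]. The count is strict since the component of [r]
   already sends out an edge of [G] before any joining edge is spent; each further component brings
   at least one boundary edge and costs one joining edge. *)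
pose good (C : {set 'I_n}) := [/\ r \in C, C \subset S,
  forall u v, u \in C -> v \in S -> adj G u v -> v \in C &
  exists F : {set {set 'I_n}}, [/\ F \subset H, F \subset inner S :\: G,
    #|F| < #|G :&: across S :&: [set t : {set 'I_n} | ~~ (t \subset ~: C)]| & conn_in (adj (G :|: F)) r C]].
have comp_sub v : v \in S -> comp v \subset S.
  by move=> vS; apply/subsetP => y; rewrite inE; apply: inside_sub_comp.
have comp_closed v a b : v \in S -> a \in comp v -> b \in S -> adj G a b -> b \in comp v.
  move=> vS av bS ab; have aS := subsetP (comp_sub v vS) a av.
  move: av; rewrite !inE => av; apply: connect_trans av (connect1 _).
  by rewrite /inside /= aS bS.
have comp_conn F v y : v \in S -> y \in comp v -> connect (inside (adj (G :|: F)) (comp v)) v y.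
  move=> vS; rewrite inE => /connectP[p pp ->].
  have : v \in comp v by rewrite inE.
  have ext : forall w, w \in comp v -> path (inside (adj G) S) w p ->
     connect (inside (adj (G :|: F)) (comp v)) w (last w p).
    elim: p {pp} => [|a p IH] w wv //= /andP[wa pa].
    have av : a \in comp v by move: wa => /and3P[_ aS wa]; apply: comp_closed wv aS wa.
    apply: connect_trans (connect1 _) (IH _ av pa).
    by move: wa => /and3P[_ _ wa]; rewrite /inside /= wv av (adj_mono (subsetUl _ _)).
  by move=> vv; apply: ext.
have edge_out v z : v \in S -> z \notin comp v ->
    exists a b, [/\ a \in comp v, b \notin S & adj G a b].
  move=> vS zv; have vv : v \in comp v by rewrite inE.
  have [a [b [av bv ab]]] := exists_cut_edge cG vv zv.
  by exists a, b; split=> //; apply: contra bv => bS; apply: comp_closed av bS ab.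
suff grow : forall m C, #|S :\: C| < m -> good C ->
    exists F : {set {set 'I_n}}, [/\ F \subset H, F \subset inner S :\: G,
      #|F| <= #|G :&: across S| & conn_in (adj (G :|: F)) r S].
  have /existsP[z zS] : [exists z, z \notin S].
    apply: contraR ST; rewrite negb_exists => /forallP allS; apply/eqP/setP => z.
    by rewrite inE; have := allS z; rewrite negbK.
  apply: (grow #|S :\: comp r|.+1 (comp r)) => //; split.
  - by rewrite inE.
  - exact: comp_sub.
  - by move=> u v; apply: comp_closed.
  exists set0; split; rewrite ?sub0set //.
    rewrite cards0; have [a [b [ar bS ab]]] := edge_out r z rS (contra (subsetP (comp_sub r rS) z) zS).
    apply/card_gt0P; exists [set a; b]; have aS := subsetP (comp_sub r rS) a ar.
    by rewrite in_setI [_ \in _ :&: across S]in_setI pair_across // [_ \in G]ab inE subUset !sub1set !in_setC ar.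
  apply/conn_inP; split; first by rewrite inE.
  by move=> y; apply: comp_conn.
elim=> // m IH C; rewrite ltnS => Cm [rC CS Cclosed [F [FH FI Fcard /conn_inP[_ Cconn]]]].
have [CE|CneS] := eqVneq C S.
  exists F; split=> //; first by apply: leq_trans (ltnW Fcard) (subset_leq_card (subsetIl _ _)).
  by apply/conn_inP; split=> // y; rewrite -CE; apply: Cconn.
have [z zS zC] : exists2 z, z \in S & z \notin C.
  by apply/subsetPn; apply: contra CneS => SC; rewrite eqEsubset CS.
have [u [v [uC vC uv]]] : exists u v, [/\ u \in C, v \notin C & inside (adj (G :|: H)) S u v].
  have /connectP[p] := rconn z zS; have := rC; move: (r) => y.
  elim: p y => [|w p IHp] y yC /=.
    by move=> _ zy; rewrite zy yC in zC.
  case/andP=> yw pw zl; have [wC|wC] := boolP (w \in C); first exact: IHp wC pw zl.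
  by exists y, w.
move: uv => /and3P[uS vS]; rewrite /adj inE => /orP[uvG|uvH].
  by rewrite (Cclosed u v) in vC.
have uvG : [set u; v] \notin G by apply: contra vC => uvG; apply: Cclosed uC vS uvG.
have vsym a b : connect (inside (adj G) S) a b = connect (inside (adj G) S) b a.
  by apply: sym_connect_sym => x y; rewrite /inside /= adj_sym andbCA.
have DC y : y \in comp v -> y \notin C.
  rewrite inE => vy; apply: contra vC => yC.
  move: vy; rewrite vsym => /connectP[p]; elim: p y yC => [|w p IHp] y yC /=.
    by move=> _ ->.
  by case/andP => /and3P[_ wS yw] pw vl; apply: (IHp w) => //; apply: Cclosed yC wS yw.
have [|a [b [av bS ab]]] := edge_out v r vS.
  by apply/negP => /DC; rewrite rC.
have aS := subsetP (comp_sub v vS) a av.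
apply: (IH (C :|: comp v)).
  apply: leq_trans Cm; apply: proper_card; apply/properP; split.
    by rewrite setDS // subsetUl.
  by exists v; rewrite !inE ?vC ?vS //= connect0 orbT.
split.
- by rewrite inE rC.
- by rewrite subUset CS comp_sub.
- move=> x y; rewrite !in_setU => /orP[xC|xv] yS xy; apply/orP.
    by left; apply: Cclosed xC yS xy.
  by right; apply: comp_closed xv yS xy.
exists ([set u; v] |: F); split.
- by rewrite subUset sub1set uvH.
- by rewrite subUset FI sub1set in_setD uvG inE (subsetP gH) // subUset !sub1set uS vS.
- apply: leq_ltn_trans (_ : _ <= #|F|.+1) _.
    by rewrite cardsU1; case: (_ \notin _).
  apply: leq_ltn_trans Fcard _; apply: proper_card; apply/properP; split.
    apply: setIS; apply/subsetP => t; rewrite !inE; apply: contra => tC.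
    by apply: subset_trans tC _; rewrite setCU subsetIl.
  exists [set a; b]; first by rewrite in_setI [_ \in _ :&: across S]in_setI pair_across // [_ \in G]ab inE subUset !sub1set !in_setC !in_setU av orbT.
  rewrite in_setI negb_and [X in _ || ~~ X]inE negbK subUset !sub1set !in_setC (DC _ av) /= orbC.
  by apply/orP; left; apply: contra bS => bC; apply: subsetP CS _ bC.
apply/conn_inP; split; first by rewrite inE rC.
have toC y : y \in C -> connect (inside (adj (G :|: ([set u; v] |: F))) (C :|: comp v)) r y.
  move=> yC; apply: connect_inside (Cconn y yC); rewrite ?subsetUl //.
  by rewrite setUS // subsetUr.
move=> y; rewrite in_setU => /orP[/toC//|yv].
apply: connect_trans (toC u uC) _.
apply: connect_trans (connect1 _) (_ : connect _ v y).
  by rewrite /inside /= !in_setU uC !inE connect0 orbT /adj !inE eqxx orbT.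
apply: connect_sub (comp_conn ([set u; v] |: F) v y vS yv) => c d /and3P[cv dv cd].
by apply: connect1; rewrite /inside /= !in_setU cv dv !orbT.
Qed.

End GraphSets.

(** * Product measures *)

Section Bernoulli.
Local Open Scope ring_scope.
Variable R : realFieldType.

Lemma bernoulli (a : R) m : -1 <= a -> 1 + m%:R * a <= (1 + a) ^+ m.
Proof.
move=> a1; elim: m => [|m IH]; first by rewrite mul0r addr0 expr0.
have : (1 + a) * (1 + m%:R * a) <= (1 + a) * (1 + a) ^+ m by rewrite ler_wpM2l //; lra.
rewrite -exprS; apply: le_trans.
have : 0 <= m%:R * a ^+ 2 by rewrite mulr_ge0 ?sqr_ge0.
by rewrite -natr1; lra.
Qed.

(** Stands in for [(1 + q)^m <= exp(m q)], as [expr_oneB_le] does for [(1 - q)^m <= exp(- m q)];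
    this keeps all estimates polynomial. Both combine Bernoulli's inequality with
    [(1 + q)(1 - q) <= 1]. *)
Lemma expr_oneD_le (q : R) m : 0 <= q -> (1 + q) ^+ m * (1 - m%:R * q) <= 1.
Proof.
move=> q0; have [mq|mq] := leP (1 - m%:R * q) 0.
  by apply: le_trans ler01; rewrite mulr_ge0_le0 // exprn_ge0 //; lra.
case: m mq => [|m] mq; first by rewrite expr0 mul1r mul0r subr0.
have q1 : q < 1.
  have : 0 <= m%:R * q by rewrite mulr_ge0.
  by move: mq; rewrite -natr1; lra.
apply: le_trans (_ : _ <= (1 + q) ^+ m.+1 * (1 - q) ^+ m.+1) _.
  rewrite ler_wpM2l ?exprn_ge0 //; first by lra.
  by have := @bernoulli (- q) m.+1; rewrite mulrN; apply; lra.
by rewrite -exprMn exprn_ile1 //; nra.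
Qed.

Lemma expr_oneB_le (q : R) m : 0 <= q -> q <= 1 -> (1 - q) ^+ m * (1 + m%:R * q) <= 1.
Proof.
move=> q0 q1; apply: le_trans (_ : _ <= (1 - q) ^+ m * (1 + q) ^+ m) _.
  by rewrite ler_wpM2l ?exprn_ge0 ?bernoulli //; lra.
by rewrite -exprMn exprn_ile1 //; nra.
Qed.

End Bernoulli.

Section ProductMeasure.
Local Open Scope ring_scope.
Variables (R : realFieldType) (T : finType).
Implicit Types (w : T -> R) (H K X : {set T}).

Definition pw w H : R := \prod_t (if t \in H then w t else 1 - w t).

Lemma pw_ge0 w H : (forall t, 0 <= w t <= 1) -> 0 <= pw w H.
Proof.
move=> w01; apply: prodr_ge0 => t _; have /andP[w0 w1] := w01 t.
by case: ifP; rewrite ?subr_ge0.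
Qed.

Lemma sum_pw_prod w (a b : T -> R) :
  \sum_(H : {set T}) pw w H * \prod_t (if t \in H then a t else b t) =
  \prod_t (w t * a t + (1 - w t) * b t).
Proof.
rewrite (bigA_distr 1 +%R (fun t => w t * a t)) /=; apply: eq_bigr => H _.
by rewrite /pw -big_split; apply: eq_bigr => t _ /=; case: ifP.
Qed.

Lemma sum_pw w : \sum_(H : {set T}) pw w H = 1.
Proof.
transitivity (\sum_(H : {set T}) pw w H * \prod_t (if t \in H then 1 else 1)).
  by apply: eq_bigr => H _; rewrite big1 ?mulr1 // => t _; case: ifP.
by rewrite sum_pw_prod big1 // => t _; rewrite !mulr1 addrC subrK.
Qed.

Lemma prod_if_const X (c : R) : \prod_t (if t \in X then c else 1) = c ^+ #|X|.
Proof. by rewrite -big_mkcond prodr_const. Qed.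

Lemma sub_indicator K H : (K \subset H)%:R = \prod_t (if t \in H then 1 else if t \in K then 0 else 1) :> R.
Proof.
have [KH|/subsetPn[t tK tH]] := boolP (K \subset H).
  by rewrite big1 // => t _; case: ifPn => // tH; rewrite (contraNF (subsetP KH t)).
by rewrite (bigD1 t) //= (negPf tH) tK mul0r.
Qed.

Lemma trace_indicator X K H : K \subset X -> (H :&: X == K)%:R =
  \prod_t (if t \in H then (if t \in X :\: K then 0 else 1) else if t \in K then 0 else 1) :> R.
Proof.
move=> KX; have [<-|HK] := eqVneq (H :&: X) K.
  rewrite big1 // => t _; rewrite !inE; case: (t \in H) => //=; first by case: (t \in X).
have /existsP[t tP] : [exists t, (t \in H :&: X) != (t \in K)].
  apply: contraR HK; rewrite negb_exists => /forallP eqs.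
  by apply/eqP/setP => t; apply/eqP; have := eqs t; rewrite negbK.
rewrite (bigD1 t) //=; move: tP; rewrite !inE; have := subsetP KX t.
by case: (t \in H); case: (t \in X); case: (t \in K) => //= KX1 _; rewrite ?mul0r //; have := KX1 isT.
Qed.

Lemma pw_trace w X K : K \subset X ->
  \sum_(H : {set T}) pw w H * (H :&: X == K)%:R = \prod_(t in X) (if t \in K then w t else 1 - w t).
Proof.
move=> KX; rewrite (eq_bigr _ (fun H _ => congr1 _ (trace_indicator H KX))).
rewrite sum_pw_prod [RHS]big_mkcond; apply: eq_bigr => t _.
rewrite !inE; have := subsetP KX t.
by case: (t \in X); case: (t \in K) => //= KX1;
  rewrite ?mulr1 ?mulr0 ?addr0 ?add0r ?[w t + _]addrC ?subrK //; have := KX1 isT.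
Qed.

End ProductMeasure.

(** * First moment over connected sets *)

Section FirstMoment.
Local Open Scope ring_scope.
Variables (R : realFieldType) (n D : nat) (G : {set {set 'I_n}}).
Hypotheses (G_graph : is_graph G) (G_conn : connected G) (G_deg : degenerate D G).
Implicit Types (S : {set 'I_n}) (F H : {set {set 'I_n}}).

(* Sets that are not pairs get weight [0], so that [expect] may sum over all [H]. *)
Definition edge_wt (p : R) (t : {set 'I_n}) : R := if t \in pairs n then p else 0.
Definition expect (p : R) (f : {set {set 'I_n}} -> R) : R :=
  \sum_(H : {set {set 'I_n}}) pw (edge_wt p) H * f H.

Lemma inner_notin_across S t : t \in inner S -> t \notin across S.
Proof. by move=> tS; rewrite (disjointFr (inner_across_disj S)). Qed.

Lemma touch_pairs S t : (t \in inner S) || (t \in across S) -> t \in pairs n.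
Proof. by rewrite !inE -andb_orr => /andP[]. Qed.

Lemma expect_pattern (p u z : R) S F : F \subset inner S ->
  expect p (fun H => (F \subset H)%:R * u ^+ #|H :&: across S| * z ^+ #|H :&: inner S|) =
  (p * z) ^+ #|F| * (1 + (z - 1) * p) ^+ #|inner S :\: F| * (1 - (1 - u) * p) ^+ #|across S|.
Proof.
move=> FS; rewrite /expect.
rewrite (eq_bigr (fun H => pw (edge_wt p) H *
   \prod_t (if t \in H then (if t \in across S then u else 1) * (if t \in inner S then z else 1)
            else (if t \in F then 0 else 1)))); last first.
  move=> H _; congr (_ * _); rewrite sub_indicator -!prod_if_const -!big_split /=.
  apply: eq_bigr => t _; rewrite !in_setI.
  by case: (t \in H); rewrite /= ?mul1r ?mulr1.
rewrite sum_pw_prod -!prod_if_const -!big_split /=; apply: eq_bigr => t _.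
rewrite in_setD /edge_wt; have := @inner_notin_across S t; have := @touch_pairs S t.
have := subsetP FS t.
case: (t \in F); case: (t \in inner S) => /= H1 H2 H3.
- by rewrite (negPf (H3 isT)) H2 //; ring.
- by have := H1 isT.
- by rewrite (negPf (H3 isT)) H2 //; ring.
by case: (boolP (t \in across S)) H2 => [_ -> //|_ _]; ring.
Qed.

Section Kraft.
Variables (x q : R) (r : 'I_n).
Hypotheses (x01 : 0 <= x <= 1) (q01 : 0 <= q <= 1).

Definition joined (S : {set 'I_n}) (F : {set {set 'I_n}}) : bool :=
  (F \subset inner S :\: G) && conn_in (adj (G :|: F)) r S.

Let cluster_wt S F : R :=
  x ^+ #|G :&: inner S| * q ^+ #|F| * (1 - x) ^+ #|G :&: across S| * (1 - q) ^+ #|touch S :\: G :\: F|.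

Let wt (t : {set 'I_n}) : R := if t \in G then x else if t \in pairs n then q else 0.

Let cluster_wtE S F : F \subset inner S :\: G ->
  cluster_wt S F = \sum_(H : {set {set 'I_n}}) pw wt H * (H :&: touch S == (G :&: inner S) :|: F)%:R.
Proof.
move=> FS; rewrite pw_trace; last first.
  apply: subset_trans (subsetUl _ _); rewrite subUset subsetIr.
  by apply: subset_trans FS (subsetDl _ _).
rewrite /cluster_wt -!prod_if_const -!big_split /= [RHS]big_mkcond; apply: eq_bigr => t _.
rewrite /touch !(in_setU, in_setI, in_setD) /wt.
have := @inner_notin_across S t; have := @touch_pairs S t; have := subsetP FS t.
rewrite in_setD; case: (t \in F) => [/(_ isT)/andP[/negPf-> tS] tP tA|_].
  by rewrite tS /= tP ?tS //=; ring.
case: (t \in inner S) => /= [-> // /(_ isT)/negPf->|]; first by case: (t \in G) => /=; ring.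
case: (t \in across S) => /= [-> // _|_ _]; first by case: (t \in G) => /=; ring.
by rewrite !andbF; ring.
Qed.

(** No open pair leaves [S] and those inside connect it to [r]. So [H] determines [S] as the cluster
    of [r], and then [F] as the open pairs outside [G]. *)
Let cluster_unique H S F : joined S F -> H :&: touch S = (G :&: inner S) :|: F ->
  S = [set y | connect (adj H) r y] /\ F = (H :&: touch S) :\: G.
Proof.
case/andP => FS /conn_inP[rS rconn] HE.
have Sinner t : t \in H -> t \in touch S -> t \in inner S.
  move=> tH tT; have : t \in H :&: touch S by rewrite inE tH.
  by rewrite HE inE => /orP[/setIP[]//|/(subsetP FS)/setDP[]].
split; last first.
  rewrite HE setDUl; apply/setP => t; rewrite in_setU !in_setD in_setI.
  have := subsetP FS t; rewrite in_setD; case: (t \in F) => [/(_ isT)/andP[-> _]|_]; rewrite ?orbT //.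
  by case: (t \in G); rewrite ?andbF.
apply/setP => y; rewrite inE; apply/idP/idP => [/rconn|].
  apply: connect_sub => a b /and3P[aS bS]; rewrite /adj => ab; apply: connect1.
  suff : [set a; b] \in H :&: touch S by rewrite inE => /andP[].
  rewrite HE; move: ab; rewrite !in_setU in_setI => /orP[ab|->]; rewrite ?orbT //.
  by rewrite ab (adj_inner G_graph ab).
case/connectP => p; elim: p (r) rS => [|a p IH] b bS /= => [_ ->//|/andP[ba pp yl]].
apply: (IH a) => //; apply: contraT => aS.
have := Sinner _ ba; rewrite in_setU pair_across ?orbT // => /(_ isT).
by move/inner_notin_across; rewrite pair_across.
Qed.

(* Keep each edge of [G] with probability [x] and open every other pair with probability
   [q]. The summand is the probability that the open edges touching [S] are exactly those
   of [G] inside [S] together with [F], in which case [S] is the open cluster of [r];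
   these events are disjoint. *)
Lemma kraft : \sum_(SF : {set 'I_n} * {set {set 'I_n}} | joined SF.1 SF.2)
  (x ^+ #|G :&: inner SF.1| * q ^+ #|SF.2| * (1 - x) ^+ #|G :&: across SF.1|
   * (1 - q) ^+ #|touch SF.1 :\: G :\: SF.2|) <= 1.
Proof.
rewrite (eq_bigr (fun SF => \sum_(H : {set {set 'I_n}})
   pw wt H * (H :&: touch SF.1 == (G :&: inner SF.1) :|: SF.2)%:R)); last first.
  by move=> SF /andP[FS _]; rewrite -cluster_wtE.
rewrite exchange_big -[leRHS](sum_pw wt) /=; apply: ler_sum => H _.
rewrite -mulr_sumr -[leRHS]mulr1 ler_wpM2l //.
  apply: pw_ge0 => t; rewrite /wt; case: ifP => // _; case: ifP => // _.
  by rewrite lexx ler01.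
pose M := [pred SF | joined SF.1 SF.2 && (H :&: touch SF.1 == (G :&: inner SF.1) :|: SF.2)].
have -> : \sum_(SF | joined SF.1 SF.2) (H :&: touch SF.1 == (G :&: inner SF.1) :|: SF.2)%:R = #|M|%:R :> R.
  by rewrite -sum1_card natr_sum [RHS]big_mkcondr; apply: eq_bigr => SF _; case: ifP.
rewrite (ler_nat _ _ 1%N).
apply/card_le1_eqP => -[S F] [S' F']; rewrite !inE /= => /andP[J1 /eqP H1] /andP[J2 /eqP H2].
have [SE FE] := cluster_unique J1 H1; have [SE' FE'] := cluster_unique J2 H2.
by congr pair; rewrite ?SE ?SE' // FE FE' SE SE'.
Qed.
End Kraft.

Lemma pw_edge_wt0 (p : R) H : ~~ (H \subset pairs n) -> pw (edge_wt p) H = 0.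
Proof.
by case/subsetPn => t tH tP; rewrite /pw (bigD1 t) //= tH /edge_wt (negPf tP) mul0r.
Qed.

Lemma edge_wt01 (p : R) t : 0 <= p <= 1 -> 0 <= edge_wt p t <= 1.
Proof. by rewrite /edge_wt; case: ifP => // _ _; rewrite lexx ler01. Qed.

Lemma expect_le (p : R) f g : 0 <= p <= 1 -> (forall H, H \subset pairs n -> f H <= g H) ->
  expect p f <= expect p g.
Proof.
move=> p01 fg; apply: ler_sum => H _; have [HP|HP] := boolP (H \subset pairs n).
  by rewrite ler_wpM2l ?fg //; apply: pw_ge0 => t; apply: edge_wt01.
by rewrite pw_edge_wt0 // !mul0r.
Qed.

Section Bound.
Variables (eps c x theta u z rho : R) (r : 'I_n).
Hypotheses (eps_gt0 : 0 < eps) (eps_le : eps <= n%:R) (c_gt0 : 0 < c).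
Hypotheses (x_gt0 : 0 < x) (x_lt1 : x < 1) (th_gt0 : 0 < theta) (th_le1 : theta <= 1).
Hypotheses (th_eps : theta * eps <= 1) (z_ge1 : 1 <= z) (z_eps : (z - 1) * eps <= 1).
Hypotheses (u_ge0 : 0 <= u) (u_le1 : u <= 1) (zu : z * u <= theta * (1 - x)).
Hypotheses (rho_ge0 : 0 <= rho)
  (rho_le : rho <= x ^+ D * (1 - theta * eps) * (1 - (z - 1) * eps) * (1 + (1 - u) * eps * c)).
Let p : R := eps / n%:R.

Let n_gt0 : 0 < n%:R :> R. Proof. by rewrite ltr0n (leq_ltn_trans _ (ltn_ord r)). Qed.
Let p_ge0 : 0 <= p. Proof. by rewrite divr_ge0 ?ltW. Qed.
Let p_le1 : p <= 1. Proof. by rewrite ler_pdivrMr // mul1r. Qed.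
Let np : n%:R * p = eps. Proof. by rewrite mulrC divfK // gt_eqF. Qed.

(** The hypothesis on [rho] is a budget per vertex of [S]. Losses: [x ^ D] for keeping the inner
    edges of [G], [1 - theta * eps] for closing other pairs at [S], [1 - (z - 1) * eps] for the tilt
    inside. The gain is the last factor, from the at least [c n] pairs leading out of [S] at each of
    its vertices. *)
Let term_le S F : F \subset inner S :\: G -> (#|F| <= #|G :&: across S|)%N ->
  c * n%:R <= #|~: S|%:R ->
  u ^+ #|G :&: across S| * rho ^+ #|S| *
  ((p * z) ^+ #|F| * (1 + (z - 1) * p) ^+ #|inner S :\: F| * (1 - (1 - u) * p) ^+ #|across S|) <=
  x ^+ #|G :&: inner S| * (theta * p) ^+ #|F| * (1 - x) ^+ #|G :&: across S|
   * (1 - theta * p) ^+ #|touch S :\: G :\: F|.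
Proof.
move=> FS Fb Sc; set b := #|G :&: across S| in Fb *; set f := #|F| in Fb *; set s := #|S|.
set i := #|inner S :\: F|; set be := #|across S|; set o := #|_ :\: F|.
have [[[[[x0' x1'] z1'] ze'] u0'] u1'] := (x_gt0, x_lt1, z_ge1, z_eps, u_ge0, u_le1).
have [[zu' th_eps'] th_gt0'] := (zu, th_eps, th_gt0).
have x1 : 0 <= 1 - x by lra.
have z_ge0 : 0 <= z by lra.
have [zm1 um1 um1' z1 th1] : [/\ 0 <= z - 1, 0 <= 1 - u, 1 - u <= 1, 0 <= 1 - (z - 1) * eps & 0 <= 1 - theta * eps].
  by split; lra.
have u_lex : u <= 1 - x.
  apply: (@le_trans _ _ (z * u)); first by rewrite ler_peMl.
  by apply: le_trans zu _; rewrite ler_piMl.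
have uz : u * z <= (1 - x) * theta by lra.
have q1_ge0 : 0 <= (z - 1) * p by rewrite mulr_ge0.
have q2_ge0 : 0 <= (1 - u) * p by rewrite mulr_ge0.
have q2_le1 : (1 - u) * p <= 1 by rewrite mulr_ile1.
have th_p : theta * p <= 1 by rewrite mulr_ile1 // ltW.
have th_p0 : 0 <= theta * p by rewrite mulr_ge0 // ltW.
have ec0 : 0 <= (1 - u) * eps * c by rewrite !mulr_ge0 // ltW.
have q1_ge1 : 1 <= 1 + (z - 1) * p by rewrite lerDl.
have q1_gt0 : 0 <= 1 + (z - 1) * p by rewrite addr_ge0.
have q2_c0 : 0 <= 1 - (1 - u) * p by rewrite subr_ge0.
have q2_c1 : 1 - (1 - u) * p <= 1 by rewrite gerBl.
have th_pc0 : 0 <= 1 - theta * p by rewrite subr_ge0.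
have th_pc1 : 1 - theta * p <= 1 by rewrite gerBl.
have th_pm1 : -1 <= - (theta * p) by rewrite lerN2.
have u1 : 0 <= 1 + (1 - u) * eps * c by rewrite addr_ge0.
have across_base : 1 + (1 - u) * eps * c <= 1 + #|~: S|%:R * ((1 - u) * p).
  have -> : (1 - u) * eps * c = c * n%:R * ((1 - u) * p) by rewrite -np; ring.
  by rewrite lerD2l ler_wpM2r.
have across_base0 := le_trans u1 across_base.
have x0 := ltW x_gt0.
(* As [f <= b], each joining edge is matched with a boundary edge of [G] through
   [z * u <= theta * (1 - x)]; unmatched boundary edges use [u <= 1 - x]. *)
have ub : u ^+ b * z ^+ f <= (1 - x) ^+ b * theta ^+ f.
  rewrite -(subnK Fb) !exprD -!mulrA -!exprMn; apply: ler_pM.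
  - by rewrite exprn_ge0.
  - by rewrite exprn_ge0 // mulr_ge0.
  - by rewrite lerXn2r ?nnegrE.
  by apply: lerXn2r uz; rewrite nnegrE mulr_ge0 // ltW.
have touch_le : (#|touch S| <= n * s)%N by rewrite mulnC card_touch.
have inner_part : (1 + (z - 1) * p) ^+ i * (1 - (z - 1) * eps) ^+ s <= 1.
  have i_le : (i <= n * s)%N.
    apply: leq_trans touch_le; apply: subset_leq_card.
    exact: subset_trans (subsetDl _ _) (subsetUl _ _).
  apply: le_trans (_ : _ <= (1 + (z - 1) * p) ^+ (n * s) * (1 - (z - 1) * eps) ^+ s) _.
    by rewrite ler_wpM2r ?exprn_ge0 ?ler_weXn2l.
  rewrite exprM -exprMn exprn_ile1 //; first by rewrite mulr_ge0 ?exprn_ge0.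
  have -> : (z - 1) * eps = n%:R * ((z - 1) * p) by rewrite mulrCA np.
  exact: expr_oneD_le.
have across_part : (1 - (1 - u) * p) ^+ be * (1 + (1 - u) * eps * c) ^+ s <= 1.
  have be_ge : (#|~: S| * s <= be)%N by rewrite mulnC card_across.
  apply: le_trans (_ : _ <= (1 - (1 - u) * p) ^+ (#|~: S| * s) * (1 + #|~: S|%:R * ((1 - u) * p)) ^+ s) _.
    apply: ler_pM; [by rewrite exprn_ge0 | by rewrite exprn_ge0 | by rewrite ler_wiXn2l |].
    by rewrite lerXn2r ?nnegrE.
  rewrite exprM -exprMn exprn_ile1 ?expr_oneB_le //.
  by rewrite mulr_ge0 ?exprn_ge0.
have x_part : (x ^+ D) ^+ s <= x ^+ #|G :&: inner S|.
  by rewrite -exprM ler_wiXn2l ?degenerate_inner // ltW.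
have th_part : (1 - theta * eps) ^+ s <= (1 - theta * p) ^+ o.
  have o_le : (o <= n * s)%N.
    apply: leq_trans touch_le; apply: subset_leq_card.
    exact: subset_trans (subsetDl _ _) (subsetDl _ _).
  apply: le_trans (_ : _ <= (1 - theta * p) ^+ (n * s)) _; last by rewrite ler_wiXn2l.
  rewrite exprM lerXn2r ?nnegrE ?exprn_ge0 //.
  by have := bernoulli n th_pm1; rewrite mulrN mulrCA np.
have rho_s : rho ^+ s <= (x ^+ D) ^+ s * (1 - theta * eps) ^+ s * (1 - (z - 1) * eps) ^+ s
    * (1 + (1 - u) * eps * c) ^+ s.
  by rewrite -!exprMn lerXn2r ?nnegrE ?mulr_ge0 ?exprn_ge0.
rewrite [(p * z) ^+ f]exprMn [(theta * p) ^+ f]exprMn.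
set I1 := (1 + (z - 1) * p) ^+ i in inner_part *; set B1 := (1 - (1 - u) * p) ^+ be in across_part *.
have I0 : 0 <= I1 by rewrite exprn_ge0.
have B0 : 0 <= B1 by rewrite exprn_ge0.
have pf0 : 0 <= p ^+ f by rewrite exprn_ge0.
have zf0 : 0 <= z ^+ f by rewrite exprn_ge0.
have regroupl (a1 a2 a3 a4 a5 a6 : R) :
    a1 * a2 * (a3 * a4 * a5 * a6) = (a1 * a4) * a3 * (a2 * a5 * a6) by ring.
have regroupr (a1 a2 a3 a4 a5 : R) :
    a1 * (a2 * a3) * a4 * a5 = (a4 * a2) * a3 * (a1 * a5) by ring.
have regroup (a1 a2 a3 a4 a5 a6 : R) :
    a1 * a2 * a3 * a4 * a5 * a6 = a1 * a2 * ((a5 * a3) * (a6 * a4)) by ring.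
rewrite regroupl regroupr.
have u_b0 : 0 <= u ^+ b by rewrite exprn_ge0.
have rho_s0 : 0 <= rho ^+ s by rewrite exprn_ge0.
apply: ler_pM; [by rewrite !mulr_ge0 | by rewrite !mulr_ge0 | by apply: ler_wpM2r |].
apply: (@le_trans _ _ ((x ^+ D) ^+ s * (1 - theta * eps) ^+ s)); last first.
  by apply: ler_pM; rewrite ?exprn_ge0.
apply: (@le_trans _ _ ((x ^+ D) ^+ s * (1 - theta * eps) ^+ s * (1 - (z - 1) * eps) ^+ s
    * (1 + (1 - u) * eps * c) ^+ s * I1 * B1)).
  by rewrite ler_wpM2r // ler_wpM2r.
set X := (x ^+ D) ^+ s; set Th := _ ^+ s; set Z := _ ^+ s in inner_part *; set U := _ ^+ s in across_part *.
rewrite regroup -[leRHS]mulr1 ler_wpM2l ?mulr_ge0 ?exprn_ge0 //.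
by rewrite mulr_ile1 ?mulr_ge0 ?exprn_ge0.
Qed.

(** For each connected [S] a single joining set [F] inside [H] suffices, so the sum over [S] is at
    most a sum over pairs [(S, F)]. There the expectation factorizes, and [term_le] reduces it to
    [kraft]. *)
Lemma first_moment :
  expect p (fun H => \sum_(S : {set 'I_n} | (c * n%:R <= #|~: S|%:R) && conn_in (adj (G :|: H)) r S)
     u ^+ (#|G :&: across S| + #|H :&: across S|) * z ^+ #|H :&: inner S| * rho ^+ #|S|) <= 1.
Proof.
have p01 : 0 <= p <= 1 by rewrite p_ge0.
pose Q S F := joined r S F && ((#|F| <= #|G :&: across S|)%N && (c * n%:R <= #|~: S|%:R)).
pose cf S := u ^+ #|G :&: across S| * rho ^+ #|S|.
pose pat S F H : R := (F \subset H)%:R * u ^+ #|H :&: across S| * z ^+ #|H :&: inner S|.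
have z0 : 0 <= z by apply: le_trans z_ge1; exact: ler01.
have cf0 S : 0 <= cf S by rewrite mulr_ge0 ?exprn_ge0.
have pat0 S F H : 0 <= pat S F H by rewrite !mulr_ge0 ?exprn_ge0.
apply: (@le_trans _ _ (expect p (fun H => \sum_(SF : _ * _ | Q SF.1 SF.2) cf SF.1 * pat SF.1 SF.2 H))).
  apply: expect_le => // H HP.
  rewrite -(pair_big_dep xpredT Q (fun S F => cf S * pat S F H)) /=.
  rewrite [leLHS]big_mkcond /=; apply: ler_sum => S _.
  case: ifPn => [/andP[cS conS]|_]; last by apply: sumr_ge0 => F _; rewrite mulr_ge0.
  have ST : S != [set: 'I_n].
    apply: contraTneq cS => ->; rewrite setCT cards0 -ltNge mulr_gt0 //.
  have [F [FH FS Fb conF]] := few_joining_edges G_conn G_graph ST conS HP.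
  rewrite (bigD1 F) /=; last by rewrite /Q /joined FS conF Fb.
  rewrite -[leLHS]addr0 lerD //; last by apply: sumr_ge0 => F' _; rewrite mulr_ge0.
  have regroup (a1 a2 a3 a4 : R) : a1 * a2 * a3 * a4 = a1 * a4 * (a2 * a3) by ring.
  by rewrite /pat /cf FH mul1r exprD regroup.
rewrite /expect; under eq_bigr do rewrite mulr_sumr.
rewrite exchange_big /=.
have x01 : 0 <= x <= 1 by rewrite !ltW.
have q01 : 0 <= theta * p <= 1.
  by rewrite mulr_ge0 ?(ltW th_gt0) //= mulr_ile1 // ltW.
apply: le_trans (kraft r x01 q01).
rewrite [leRHS](bigID (fun SF : {set 'I_n} * {set {set 'I_n}} => (#|SF.2| <= #|G :&: across SF.1|)%N && (c * n%:R <= #|~: SF.1|%:R))) /=.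
rewrite -[leLHS]addr0 lerD //; last first.
  by apply: sumr_ge0 => SF _; have /andP[? ?] := x01; have /andP[? ?] := q01;
     rewrite !mulr_ge0 ?exprn_ge0 ?subr_ge0.
apply: ler_sum => -[S F] /= /andP[/andP[FS _] /andP[Fb Sc]].
apply: le_trans (term_le FS Fb Sc); rewrite -expect_pattern; last first.
  by apply: subset_trans FS (subsetDl _ _).
rewrite /expect mulr_sumr le_eqVlt; apply/orP; left; apply/eqP.
by apply: eq_bigr => H _; rewrite mulrCA.
Qed.

End Bound.
End FirstMoment.

(** * Probabilities of the two bad events *)

Section BadEvents.
Local Open Scope ring_scope.
Variables (R : realFieldType) (n D : nat) (G : {set {set 'I_n}}).
Hypotheses (G_graph : is_graph G) (G_conn : connected G) (G_deg : degenerate D G).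

(* Up to constants, [D * #|S| + #|H :&: inner S|] is the number of edges inside [S] and
   [#|G :&: across S| + #|H :&: across S|] the size of its boundary. *)
Definition sparse_cluster (c : R) (k L : nat) (H : {set {set 'I_n}}) : bool :=
  [exists r, exists S : {set 'I_n},
    [&& c * n%:R <= #|~: S|%:R, conn_in (adj (G :|: H)) r S,
     (k * (#|G :&: across S| + #|H :&: across S|) <= D * #|S| + #|H :&: inner S|)%N
     & (L <= #|S| + #|H :&: inner S|)%N]].

Definition dense_small_set (c : R) (H : {set {set 'I_n}}) : bool :=
  [exists A : {set 'I_n}, (#|A|%:R < c * n%:R) && (n <= 8 * #|H :&: inner A|)%N].

Lemma expect_sum (I : finType) (P : pred I) (p : R) (f : I -> {set {set 'I_n}} -> R) :
  expect p (fun H => \sum_(i | P i) f i H) = \sum_(i | P i) expect p (f i).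
Proof. by rewrite /expect; under eq_bigr do rewrite mulr_sumr; exact: exchange_big. Qed.

Lemma expectD (p : R) (f g : {set {set 'I_n}} -> R) :
  expect p (fun H => f H + g H) = expect p f + expect p g.
Proof. by rewrite /expect -big_split; apply: eq_bigr => H _; rewrite mulrDr. Qed.

Lemma expectZ (p a : R) (f : {set {set 'I_n}} -> R) :
  expect p (fun H => a * f H) = a * expect p f.
Proof. by rewrite /expect mulr_sumr; apply: eq_bigr => H _; rewrite mulrCA. Qed.

(* Chernoff: on the event, [u ^+ boundary * (1 + t) ^+ inside >= 1] for [u = (1 + t) ^- k],
   and another factor [1 + t] per vertex and per random edge inside [S] gains
   [(1 + t) ^+ L]. *)
Lemma prob_sparse_cluster (eps c t : R) (k L : nat) :
  0 < eps -> eps <= n%:R -> 0 < c -> 0 < t -> t < 1 -> 3 * t * eps <= 1 ->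
  4 <= k%:R * t ^+ 3 ->
  (1 + t) ^+ D.+1 <= (1 - t) ^+ D * (1 - t * eps) * (1 - 3 * t * eps) * (1 + eps * c / 2) ->
  expect (eps / n%:R) (fun H => (sparse_cluster c k L H)%:R) <= n%:R * ((1 + t) ^+ L)^-1.
Proof.
move=> eps0 epsn c0 t0 t1 teps kt rho_le.
pose u := ((1 + t) ^+ k)^-1; pose z := (1 + t) * (1 + t); pose rho := (1 + t) ^+ D.+1.
have pos m : 0 < (1 + t) ^+ m by rewrite exprn_gt0 //; lra.
have u0 : 0 <= u by rewrite invr_ge0 ltW.
(* With [x = 1 - t] and [theta = t], the condition [z * u <= theta * (1 - x)] reads [z * u <= t^2];
   as [z <= 4], this bound on [1 / u] is enough. *)
have k_large : 4 / t ^+ 2 <= (1 + t) ^+ k.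
  have := @bernoulli R t k; set y := (1 + t) ^+ k => yk.
  have {}yk : 1 + k%:R * t <= y by apply: yk; lra.
  rewrite ler_pdivrMr ?exprn_gt0 //; apply: le_trans kt _.
  rewrite (exprS _ 2) mulrA ler_wpM2r ?sqr_ge0 //; lra.
have u_half : u <= 1 / 2.
  rewrite /u mul1r lef_pV2 ?posrE // (le_trans _ k_large) // ler_pdivlMr ?exprn_gt0 //.
  by have := exprn_ile1 2 (ltW t0) (ltW t1); lra.
have zu : z * u <= t * (1 - (1 - t)).
  rewrite /u ler_pdivrMr // /z; have : t ^+ 2 * (4 / t ^+ 2) <= t ^+ 2 * (1 + t) ^+ k.
    by rewrite ler_wpM2l ?sqr_ge0.
  rewrite mulrC divfK ?expf_neq0 ?gt_eqF // => t4.
  rewrite (_ : t * (1 - (1 - t)) = t ^+ 2); last by ring.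
  apply: le_trans t4; have : (1 + t) * (1 + t) <= 2 * 2 by apply: ler_pM; lra.
  lra.
have Phi_le r := @first_moment R n D G G_graph G_conn G_deg eps c (1 - t) t u z rho r.
apply: (@le_trans _ _ (expect (eps / n%:R) (fun H => \sum_(r < n) ((1 + t) ^+ L)^-1 *
   \sum_(S : {set 'I_n} | (c * n%:R <= #|~: S|%:R) && conn_in (adj (G :|: H)) r S)
     u ^+ (#|G :&: across S| + #|H :&: across S|) * z ^+ #|H :&: inner S| * rho ^+ #|S|))).
  have z0 : 0 <= z by rewrite /z mulr_ge0 //; lra.
  have p01 : 0 <= eps / n%:R <= 1.
    have n0 : 0 < n%:R :> R by apply: lt_le_trans epsn.
    by rewrite divr_ge0 ?(ltW n0) ?(ltW eps0) //= ler_pdivrMr // mul1r.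
  apply: expect_le => // H _.
  have term0 S : 0 <= u ^+ (#|G :&: across S| + #|H :&: across S|) * z ^+ #|H :&: inner S| * rho ^+ #|S|.
    by apply: mulr_ge0 (mulr_ge0 (exprn_ge0 _ u0) (exprn_ge0 _ z0)) (exprn_ge0 _ (ltW (pos _))).
  have sum0 r : 0 <= ((1 + t) ^+ L)^-1 *
     \sum_(S : {set 'I_n} | (c * n%:R <= #|~: S|%:R) && conn_in (adj (G :|: H)) r S)
     u ^+ (#|G :&: across S| + #|H :&: across S|) * z ^+ #|H :&: inner S| * rho ^+ #|S|.
    apply: mulr_ge0; last by apply: sumr_ge0 => S _; apply: term0.
    by rewrite invr_ge0; apply: ltW (pos L).
  case: (boolP (sparse_cluster c k L H)) => [/existsP[r /existsP[S /and4P[cS conS kS LS]]]|_]; last first.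
    by apply: sumr_ge0 => r _; apply: sum0.
  rewrite (bigD1 r) //= -[leLHS]addr0 lerD //; last by apply: sumr_ge0 => r' _; apply: sum0.
  rewrite mulrC ler_pdivlMr // mul1r (bigD1 S) /= ?cS //.
  rewrite -[leLHS]addr0 lerD //; last by apply: sumr_ge0 => S' _; apply: term0.
  move: kS LS; set m := (_ + #|H :&: across S|)%N; set i := #|H :&: inner S|; set s := #|S|.
  move=> kS LS; have y1 : 1 <= 1 + t by rewrite lerDl ltW.
  have -> : u ^+ m * z ^+ i * rho ^+ s = (1 + t) ^+ ((s + i) + (D * s + i)) / (1 + t) ^+ (k * m).
    have regroup (a1 a2 a3 a4 : R) : a1 * (a2 * a2) * (a4 * a3) = (a4 * a2) * (a3 * a2) * a1 by ring.
    by rewrite /u /z /rho exprMn exprVn -!exprM mulSn !exprD regroup.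
  by rewrite ler_pdivlMr // -exprD ler_weXn2l // leq_add.
rewrite expect_sum (_ : n%:R / _ = \sum_(r < n) ((1 + t) ^+ L)^-1); last first.
  by rewrite sumr_const card_ord mulr_natl.
apply: ler_sum => r _; rewrite expectZ -[leRHS]mulr1; apply: ler_wpM2l; first by rewrite invr_ge0; apply: ltW (pos L).
have ec0 : 0 <= eps * c by rewrite mulr_ge0 // ltW.
have te0 : 0 <= t * eps by rewrite mulr_ge0 // ltW.
have zE : z = 1 + 2 * t + t ^+ 2 by rewrite /z; ring.
have t2 : t ^+ 2 <= t by rewrite expr2 ler_piMr // ltW.
have t20 : 0 <= t ^+ 2 by rewrite sqr_ge0.
have z3 : (z - 1) * eps <= 3 * t * eps by rewrite ler_wpM2r ?(ltW eps0) // zE; lra.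
have z1 : 1 <= z by rewrite zE; lra.
have xt0 : 0 < 1 - t by lra.
have xt1 : 1 - t < 1 by lra.
have te1 : t * eps <= 1 by lra.
have ze1 : (z - 1) * eps <= 1 by apply: le_trans z3 _.
have u1 : u <= 1 by lra.
apply: Phi_le eps0 epsn c0 xt0 xt1 t0 (ltW t1) te1 z1 ze1 u0 u1 zu (ltW (pos D.+1)) _.
apply: le_trans rho_le _; rewrite -!mulrA ler_wpM2l ?exprn_ge0 ?subr_ge0 ?(ltW t1) //.
rewrite ler_wpM2l //; first by rewrite subr_ge0; lra.
apply: ler_pM; [by lra | by lra | by lra |].
have : 1 / 2 * (eps * c) <= (1 - u) * (eps * c) by rewrite ler_wpM2r //; lra.
lra.
Qed.

(** Exponential moment with weight [8^8] per edge inside [A]: it is at least [8^n] on the event and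
    at most [2^n] on average, and there are [2^n] sets, so [2^n * 2^n / 8^n] remains. *)
Lemma prob_dense_small_set (eps c : R) : 0 < eps -> eps <= n%:R -> (0 < n)%N -> 0 < c ->
  2 * (8 ^+ 8 * (c * eps)) <= 1 ->
  expect (eps / n%:R) (fun H => (dense_small_set c H)%:R) <= (2 ^+ n)^-1.
Proof.
move=> eps0 epsn n0 c0 ceps; pose p := eps / n%:R; pose Z : R := 8 ^+ 8.
have nR : 0 < n%:R :> R by rewrite ltr0n.
have p01 : 0 <= p <= 1.
  by rewrite divr_ge0 ?(ltW nR) ?(ltW eps0) //= ler_pdivrMr // mul1r.
have p0 : 0 <= p by case/andP: p01.
have np : n%:R * p = eps by rewrite /p mulrC divfK // gt_eqF.
have Z1 : 1 <= Z by rewrite exprn_ege1 //; lra.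
pose P (A : {set 'I_n}) := #|A|%:R < c * n%:R.
apply: (@le_trans _ _ (expect p (fun H => \sum_(A | P A) (8 ^+ n)^-1 * Z ^+ #|H :&: inner A|))).
  apply: expect_le => // H _; case: (boolP (dense_small_set c H)) => [/existsP[A /andP[PA nA]]|_].
    rewrite (bigD1 A) //= -[leLHS]addr0 lerD //; last first.
      by apply: sumr_ge0 => B _; rewrite mulr_ge0 ?invr_ge0 ?exprn_ge0.
    rewrite mulrC ler_pdivlMr ?exprn_gt0 // mul1r /Z -exprM ler_weXn2l //.
    by rewrite ler1n.
  by apply: sumr_ge0 => B _; rewrite mulr_ge0 ?invr_ge0 ?exprn_ge0.
rewrite expect_sum.
have A_le A : P A -> expect p (fun H => (8 ^+ n)^-1 * Z ^+ #|H :&: inner A|) <= (8 ^+ n)^-1 * 2 ^+ n.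
  move=> PA; rewrite expectZ ler_wpM2l ?invr_ge0 ?exprn_ge0 //.
  have := @expect_pattern R n p 1 Z A set0 (sub0set _).
  rewrite cards0 expr0 mul1r subrr mul0r subr0 expr1n mulr1 setD0.
  have -> : expect p (fun H => (set0 \subset H)%:R * 1 ^+ #|H :&: across A| * Z ^+ #|H :&: inner A|) =
      expect p (fun H => Z ^+ #|H :&: inner A|).
    by apply: eq_bigr => H _; rewrite sub0set expr1n !mul1r.
  move=> ->; have q0 : 0 <= (Z - 1) * p by rewrite mulr_ge0 ?subr_ge0.
  have q1 : 1 <= 1 + (Z - 1) * p by rewrite lerDl.
  apply: (@le_trans _ _ ((1 + (Z - 1) * p) ^+ (#|A| * n))).
    rewrite ler_weXn2l //; apply: leq_trans (card_touch A).
    by apply: subset_leq_card; apply: subsetUl.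
  have q01 := le_trans ler01 q1.
  rewrite exprM; apply: lerXn2r; rewrite ?nnegrE ?exprn_ge0 //.
  have := expr_oneD_le #|A| q0; set y := _ ^+ #|A|.
  have y0 : 0 <= y by rewrite exprn_ge0.
  have Aq : #|A|%:R * ((Z - 1) * p) <= 1 / 2.
    apply: (@le_trans _ _ (c * n%:R * (Z * p))).
      apply: ler_pM => //; first by rewrite ltW.
      by rewrite ler_wpM2r //; lra.
    rewrite (_ : c * n%:R * (Z * p) = Z * (c * eps)); last by rewrite -np; ring.
    by move: ceps; rewrite -/Z; lra.
  have : y * (1 / 2) <= y * (1 - #|A|%:R * ((Z - 1) * p)) by rewrite ler_wpM2l //; lra.
  by lra.
apply: (@le_trans _ _ (\sum_(A : {set 'I_n}) (8 ^+ n)^-1 * 2 ^+ n)).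
  rewrite [leRHS](bigID P) /= -[leLHS]addr0 lerD //; last first.
    by apply: sumr_ge0 => A _; rewrite mulr_ge0 ?invr_ge0 ?exprn_ge0.
  exact: ler_sum.
have cardn : #|{: {set 'I_n}}| = (2 ^ n)%N by rewrite -cardsT -powersetT card_powerset cardsT card_ord.
rewrite sumr_const cardn -[leLHS]mulr_natr natrX (_ : 8 = 2 * 2 * 2); last by ring.
rewrite !exprMn; have y0 : 2 ^+ n != 0 :> R by rewrite expf_neq0 // pnatr_eq0.
move: (2 ^+ n) y0 => y y0; rewrite le_eqVlt (_ : (y * y * y)^-1 * y * y = y^-1) ?eqxx //.
by field.
Qed.

End BadEvents.

(** * Expansion of the perturbed graph *)

Section EdgeCounts.
Local Open Scope nat_scope.
Variables (n : nat) (E : {set {set 'I_n}}).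
Hypothesis E_graph : is_graph E.

Lemma nbr_incident v : nbr (adj E) v = #|[set t in E | v \in t]|.
Proof.
rewrite /nbr -(card_in_imset (f := fun u => [set v; u])); last first.
  move=> a b; rewrite !inE => va vb ab; have := adj_neq E_graph va.
  have : a \in [set v; b] by rewrite -ab !inE eqxx orbT.
  by rewrite !inE => /orP[/eqP->|/eqP//]; rewrite eqxx.
apply: eq_card => t; rewrite !inE; apply/imsetP/andP => [[u]|[tE vt]].
  by rewrite inE => vu ->; rewrite !inE eqxx.
have /cards2P[a [b [ab tab]]] : #|t| == 2 by have := subsetP E_graph t tE; rewrite inE.
move: vt; rewrite tab !inE => /orP[/eqP va|/eqP vb].
  by exists b; rewrite ?inE /adj va // -tab.
by exists a; rewrite ?inE /adj vb setUC // -tab.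
Qed.

Lemma vol_adj (S : {set 'I_n}) :
  vol (adj E) S = 2 * #|E :&: inner S| + #|E :&: across S|.
Proof.
transitivity (\sum_(t in E) #|t :&: S|).
  rewrite /vol; under eq_bigr => v _ do rewrite nbr_incident -sum1_card.
  rewrite (exchange_big_dep (fun t => t \in E)) /=; last by move=> v t _; rewrite inE => /andP[].
  apply: eq_bigr => t tE; rewrite -sum1_card; apply: eq_bigl => v.
  by rewrite !inE tE andbC.
have cardE (X : {set {set 'I_n}}) : #|E :&: X| = \sum_(t in E) (t \in X).
  rewrite -sum1_card [LHS]big_mkcond [RHS]big_mkcond; apply: eq_bigr => t _.
  by rewrite inE; case: (t \in E) => //; case: (t \in X).
rewrite !cardE big_distrr -big_split /=; apply: eq_bigr => t tE.
have tP := subsetP E_graph t tE; rewrite !inE in tP *.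
have [a [b [ab ->]]] := cards2P _ tP.
rewrite !subUset !sub1set !inE cards2 ab /=.
rewrite setIUl; have setI1 c : [set c] :&: S = if c \in S then [set c] else set0.
  by apply/setP => y; rewrite !inE; case: ifP => cS; rewrite !inE; case: eqP => // ->; rewrite cS.
rewrite !setI1; case: (a \in S); case: (b \in S); rewrite ?set0U ?setU0 ?cards1 ?cards0 //=.
by rewrite cards2 ab.
Qed.

Lemma across_cut (S : {set 'I_n}) : #|E :&: across S| <= cut (adj E) S.
Proof.
rewrite /cut; set X := [pred p | _].
apply: leq_trans (leq_imset_card (fun p => [set p.1; p.2]) X).
apply: subset_leq_card; apply/subsetP => t; rewrite !inE => /andP[tE /andP[t2 tS]].
have [a [b [ab tab]]] := cards2P _ t2; apply/imsetP.
move: tS tE; rewrite tab !subUset !sub1set !inE.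
case: (boolP (a \in S)) => aS; case: (boolP (b \in S)) => bS //= _ tE.
  by exists (a, b); rewrite // inE /= aS bS.
by exists (b, a); rewrite /= 1?setUC // inE /= aS bS /adj setUC.
Qed.

Lemma across_setC (S : {set 'I_n}) : across (~: S) = across S.
Proof. by apply/setP => t; rewrite !inE setCK; congr (_ && _); rewrite andbC. Qed.

End EdgeCounts.

Lemma connected_nbr_gt0 n (E : {set {set 'I_n}}) v : (1 < n)%N -> connected E -> (0 < nbr (adj E) v)%N.
Proof.
move=> n1 cE; have [w wv] : exists w, w != v.
  have /card_gt0P[w] : (0 < #|[set~ v]|)%N by rewrite cardsC1 card_ord; lia.
  by rewrite !inE => wv; exists w.
have vv : v \in [set v] by rewrite inE.
have wv' : w \notin [set v] by rewrite inE.
have [a [b [av _ ab]]] := exists_cut_edge cE vv wv'.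
by rewrite inE in av; apply/card_gt0P; exists b; rewrite inE -(eqP av).
Qed.

Section Expansion.
Local Open Scope nat_scope.
Variables (R : realFieldType) (n D : nat) (G : {set {set 'I_n}}).
Hypotheses (G_graph : is_graph G) (G_conn : connected G) (G_deg : degenerate D G).

(** If at least [c n] vertices lie outside [S], then either the boundary exceeds a [1/k] fraction of
    the inside count and [S] expands, or [S] is too small for a sparse cluster and its volume is at
    most three times the inside count. *)
Lemma perturbed_expansion (c : R) (k L : nat) (H : {set {set 'I_n}}) r (S : {set 'I_n}) :
  1 < n -> 0 < k -> ((16 * D)%:R * c <= 1)%R -> H \subset pairs n ->
  ~~ sparse_cluster D G c k L H -> ~~ dense_small_set c H ->
  conn_in (adj (G :|: H)) r S ->
  2 * vol (adj (G :|: H)) S <= vol (adj (G :|: H)) [set: 'I_n] ->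
  vol (adj (G :|: H)) S <= (4 * k + 4) * cut (adj (G :|: H)) S \/
  vol (adj (G :|: H)) S <= 3 * D.+1 * L.
Proof.
move=> n1 k0 Dc HP sparse dense conS half; set E := G :|: H.
have gE : is_graph E by rewrite /is_graph subUset; apply/andP.
have volS := vol_adj gE S; have cutS := across_cut E S.
have inner_le T : #|E :&: inner T| <= D * #|T| + #|H :&: inner T|.
  by rewrite setIUl (leq_trans (leq_card_setU _ _)) // leq_add2r degenerate_inner.
have innerS := inner_le S.
have acrossS : #|E :&: across S| <= #|G :&: across S| + #|H :&: across S|.
  by rewrite setIUl leq_card_setU.
have [acrossG acrossH] : #|G :&: across S| <= #|E :&: across S| /\ #|H :&: across S| <= #|E :&: across S|.
  by split; apply: subset_leq_card; apply: setSI; rewrite ?subsetUl ?subsetUr.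
move: half volS cutS innerS acrossS acrossG acrossH; rewrite -/E.
set v := vol _ S; set q := cut _ _; set i := #|H :&: inner S|; set b := #|G :&: across S|.
set a := #|H :&: across S|; set d := #|E :&: across S|; set s := #|S|; set j := #|E :&: inner S|.
move=> half volS cutS innerS acrossS acrossG acrossH.
have [cS|cS] := leP (c * n%:R)%R (#|~: S|%:R)%R.
  have [kab|kab] := leqP (k * (b + a)) (D * s + i); last first.
    left; have : k * (b + a) <= k * (q + q) by rewrite leq_mul2l; lia.
    rewrite mulnDl -mulnA; nia.
  right; have sL : s + i < L.
    rewrite ltnNge; apply: contra sparse => Ls.
    by apply/existsP; exists r; apply/existsP; exists S; rewrite cS conS kab Ls.
  have DsL : D * s + i <= D.+1 * L.
    by apply: (@leq_trans (D * L + L)); [apply: leq_add; rewrite ?leq_mul2l; lia | rewrite mulSn addnC].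
  have : b + a <= k * (b + a) by rewrite leq_pmull.
  rewrite -mulnA; lia.
(* The complement [T] spans fewer than [n/16 + n/8] edges, of volume below [3n/8]. As [n] is at most
   twice the volume of [T], over a quarter of that volume lies on the boundary. *)
left; have n_le : n <= vol (adj E) setT.
  rewrite -[n in X in X <= _](card_ord n) -cardsT -sum1_card; apply: leq_sum => w _.
  apply: connected_nbr_gt0 => // x y.
  apply: connect_sub (G_conn x y) => u w' uw; apply: connect1.
  by apply: adj_mono uw; apply: subsetUl.
have VC := volC (adj E) S; have volT := vol_adj gE (~: S).
have innerT := inner_le (~: S); rewrite across_setC in volT.
have DT : 16 * D * #|~: S| <= n.
  rewrite -(ler_nat R) natrM.
  apply: (@le_trans _ _ ((16 * D)%:R * (c * n%:R))%R).
    by rewrite ler_wpM2l // ltW.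
  by rewrite mulrA -[leRHS]mul1r ler_wpM2r.
have HT : 8 * #|H :&: inner (~: S)| < n.
  rewrite ltnNge; apply: contra dense => nT; apply/existsP; exists (~: S).
  by rewrite cS nT.
move: VC volT innerT DT HT; rewrite -/v -/d.
set vT := vol _ (~: S); set jT := #|E :&: _|; set iT := #|H :&: _|; set V := vol _ _ in n_le half *.
move=> VC volT innerT DT HT.
have : v <= 4 * q by lia.
by move=> /leq_trans; apply; rewrite leq_mul2r; lia.
Qed.

End Expansion.

(** * Choice of constants and mixing outside the bad events *)

Section WithHighProbability.
Local Open Scope ring_scope.
Variable R : archiRealFieldType.

(* [g] is what the boundary edges gain in the exponential moment; it has to beat the losses
   incurred by percolating [G], opening random edges and tilting the edges inside. *)
Lemma exists_rate (D : nat) (eps g : R) : 0 < eps -> 0 < g ->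
  exists t : R, [/\ 0 < t, t < 1, 3 * t * eps <= 1 &
    (1 + t) ^+ D.+1 <= (1 - t) ^+ D * (1 - t * eps) * (1 - 3 * t * eps) * (1 + g)].
Proof.
(* [a] collects first-order losses: [2 D + 1] from [(1 - t)^D] and from inverting [(1 + t)^(D+1)],
   [4 * eps] from the two [eps] factors. Then [t] solves [(1 - t a)(1 + g) = 1]. *)
move=> eps0 g0; pose a : R := (2 * D + 1)%:R + 4 * eps; pose t := g / ((1 + g) * a).
have a1 : 1 <= (2 * D + 1)%:R :> R by rewrite ler1n addn1.
have ae : a = (2 * D + 1)%:R + 4 * eps by [].
have a0 : 0 < a by lra.
have ga0 : 0 < (1 + g) * a by rewrite mulr_gt0 //; lra.
have t0 : 0 < t by rewrite divr_gt0.
have ta : t * a * (1 + g) = g by rewrite /t; field; rewrite !gt_eqF //; lra.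
have ta0 : 0 < t * a by rewrite mulr_gt0.
have ta1 : t * a < 1 by nra.
have tD : 0 <= t * (2 * D + 1)%:R by rewrite mulr_ge0 // ltW.
have te : 0 < t * eps by rewrite mulr_gt0.
have taE : t * a = t * (2 * D + 1)%:R + 4 * (t * eps) by rewrite ae; ring.
have t_le : t <= t * (2 * D + 1)%:R by rewrite ler_peMr // ltW.
have t1 : t < 1 by lra.
exists t; split => //; first by lra.
have y0 : 0 <= (1 + t) ^+ D.+1 by rewrite exprn_ge0 //; lra.
have x0 : 0 <= 1 - t by lra.
have e0 : 0 <= (1 - t * eps) * (1 - 3 * t * eps) by rewrite mulr_ge0 //; lra.
have one_le : 1 <= (1 - t) ^+ (2 * D + 1) * ((1 - t * eps) * (1 - 3 * t * eps)) * (1 + g).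
  have bern : 1 - t * (2 * D + 1)%:R <= (1 - t) ^+ (2 * D + 1).
    by have := @bernoulli R (- t) (2 * D + 1); rewrite mulrN [_ * t]mulrC; apply; lra.
  have eps_part : 1 - 4 * (t * eps) <= (1 - t * eps) * (1 - 3 * t * eps).
    by have : 0 <= (t * eps) ^+ 2 by [exact: sqr_ge0]; lra.
  apply: (@le_trans _ _ ((1 - t * (2 * D + 1)%:R) * (1 - 4 * (t * eps)) * (1 + g))).
    have regroup (x y : R) : (1 - x) * (1 - y) * (1 + g) = (1 - (x + y)) * (1 + g) + x * y * (1 + g).
      by ring.
    rewrite regroup -taE mulrBl mul1r ta addrK lerDl.
    have g1 : 0 <= 1 + g by lra.
    have te4 : 0 <= 4 * (t * eps) by lra.
    exact: mulr_ge0 (mulr_ge0 tD te4) g1.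
  rewrite ler_wpM2r //; first by lra.
  by apply: ler_pM => //; lra.
have yx : (1 + t) ^+ D.+1 * (1 - t) ^+ D.+1 <= 1.
  have tt : (1 + t) * (1 - t) = 1 - t ^+ 2 by ring.
  have t2 : t ^+ 2 <= 1 by have := exprn_ile1 2 (ltW t0) (ltW t1).
  by rewrite -exprMn tt exprn_ile1 ?gerBl ?subr_ge0 ?sqr_ge0.
have g1 : 0 <= 1 + g by rewrite addr_ge0 // ltW.
have key (y x z e h : R) : 0 <= y -> 0 <= z -> 0 <= e -> 0 <= h -> y * x <= 1 ->
    1 <= x * z * e * h -> y <= z * e * h.
  move=> y_ge0 z0 e_ge0 h0 yx1 xzeh; apply: (@le_trans _ _ (y * (x * z * e * h))).
    by rewrite ler_peMr.
  have -> : y * (x * z * e * h) = (y * x) * (z * e * h) by ring.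
  by rewrite ler_piMl // !mulr_ge0.
rewrite -(mulrA _ (1 - t * eps)); apply: key y0 (exprn_ge0 D x0) e0 g1 yx _.
by rewrite -exprD addSn addnn -mul2n -addn1.
Qed.

Theorem perturbed_mixing (D : nat) (eps : R) : 0 < eps ->
  exists C : nat, forall (n : nat) (G : {set {set 'I_n}}),
    (1 < n)%N -> eps <= n%:R -> is_graph G -> connected G -> degenerate D G ->
    exists2 bad : pred {set {set 'I_n}},
      expect (eps / n%:R) (fun H => (bad H)%:R) <= 2 / n%:R &
      forall H : {set {set 'I_n}}, H \subset pairs n -> ~~ bad H ->
      exists2 T : nat, (T <= C * trunc_log 2 n ^ 2)%N &
        forall (A : {set 'I_n}) x,
        `|iter T (avg (adj (G :|: H))) (fun y => (y \in A)%:R) x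
           - (vol (adj (G :|: H)) A)%:R / (vol (adj (G :|: H)) [set: 'I_n])%:R| <= 1 / 4 :> R.
Proof.
move=> eps0; pose c : R := 1 / ((16 * D)%:R + 2 * 8 ^+ 8 * eps).
have den0 : 0 < (16 * D)%:R + 2 * 8 ^+ 8 * eps.
  by rewrite ltr_wpDl // mulr_gt0 // mulr_gt0 // exprn_gt0.
have c0 : 0 < c by rewrite divr_gt0.
have cden : ((16 * D)%:R + 2 * 8 ^+ 8 * eps) * c = 1 by rewrite /c mulrC divfK // gt_eqF.
have Dc0 : 0 <= (16 * D)%:R * c by rewrite mulr_ge0 // ltW.
have ec0 : 0 <= 2 * (8 ^+ 8 * (c * eps)) by rewrite mulr_ge0 // mulr_ge0 ?exprn_ge0 // mulr_ge0 // ltW.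
have cden' : (16 * D)%:R * c + 2 * (8 ^+ 8 * (c * eps)) = 1.
  by rewrite -[RHS]cden [RHS]mulrDl; congr (_ + _); move: (8 ^+ 8) => z; ring.
have Dc : (16 * D)%:R * c <= 1 by rewrite -[leRHS]cden' lerDl.
have ec : 2 * (8 ^+ 8 * (c * eps)) <= 1 by rewrite -[leRHS]cden' lerDr.
have g0 : 0 < eps * c / 2 by rewrite divr_gt0 // mulr_gt0.
have [t [t0 t1 te rate]] := exists_rate D eps0 g0.
have t30 : 0 < t ^+ 3 by rewrite exprn_gt0.
(* [m] gives [(1 + t)^(m+1) >= 4], so the length [L] below yields [(1 + t)^L >= 4^(l+1) >= n^2],
   which beats the union over [n] roots. *)
pose k := Num.truncn (4 / t ^+ 3); pose m := Num.truncn (3 / t).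
have truncn_gt (y : R) : y < (Num.truncn y).+1%:R by apply: real_truncnS_gt; apply: num_real.
have kt : 4 <= k.+1%:R * t ^+ 3 by rewrite -ler_pdivrMr // ltW // truncn_gt.
have mt : 3 <= m.+1%:R * t by rewrite -ler_pdivrMr // ltW // truncn_gt.
(* The value of [2 * (k0^2 + 2 K^2 J)] for [k0 = 3 (D+1) L], [K = 4 (k+1) + 4] and [J = 2 (l+1)], up
   to a factor [(l+1)^2]; the 4 in the next line absorbs [(l+1)^2 <= 4 l^2]. *)
pose C0 := (18 * D.+1 ^ 2 * m.+1 ^ 2 + 8 * (4 * k.+1 + 4) ^ 2)%N.
exists (264 * (C0 * 4))%N => n G n1 epsn gG cG dG.
set l := trunc_log 2 n; pose L := (m.+1 * l.+1)%N.
have l0 : (0 < l)%N by rewrite trunc_log_gt0 //.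
have n_lt : (n < 2 ^ l.+1)%N by apply: trunc_log_ltn.
have nR : 0 < n%:R :> R by rewrite ltr0n ltnW.
exists (fun H => sparse_cluster D G c k.+1 L H || dense_small_set c H).
  apply: (@le_trans _ _ (expect (eps / n%:R) (fun H => (sparse_cluster D G c k.+1 L H)%:R) +
      expect (eps / n%:R) (fun H : {set {set 'I_n}} => (dense_small_set c H)%:R))).
    rewrite -expectD; apply: expect_le => [|H _].
      by rewrite divr_ge0 ?(ltW eps0) //= ler_pdivrMr // mul1r.
    by case: (sparse_cluster _ _ _ _ _ _); case: (dense_small_set _ _); rewrite //= ?addr0 ?add0r ?lerDl.
  have sparse_le := prob_sparse_cluster gG cG dG L eps0 epsn c0 t0 t1 te kt rate.
  have dense_le := prob_dense_small_set eps0 epsn (ltnW n1) c0 ec.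
  have pow_ge : n%:R * n%:R <= (1 + t) ^+ L.
    have m4 : 4 <= (1 + t) ^+ m.+1.
      have tm1 : -1 <= t by lra.
      by apply: le_trans (bernoulli m.+1 tm1); lra.
    apply: (@le_trans _ _ (4 ^+ l.+1)).
      rewrite (_ : 4 = 2 * 2); last by ring.
      by rewrite exprMn; apply: ler_pM => //; rewrite -natrX ler_nat ltnW.
    by rewrite exprM; apply: lerXn2r m4; rewrite nnegrE // exprn_ge0 // addr_ge0 // ltW.
  have sparse_n : n%:R * ((1 + t) ^+ L)^-1 <= 1 / n%:R.
    rewrite ler_pdivrMr ?(lt_le_trans _ pow_ge) ?mulr_gt0 //.
    by rewrite mul1r -ler_pdivrMl ?invr_gt0 // invrK.
  have dense_n : (2 ^+ n)^-1 <= 1 / n%:R :> R.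
    by rewrite div1r lef_pV2 ?posrE ?exprn_gt0 // -natrX ler_nat ltnW // ltn_expl.
  rewrite (_ : 2 / n%:R = 1 / n%:R + 1 / n%:R); last by rewrite -mulrDl; congr (_ / _); ring.
  by apply: lerD; [apply: le_trans sparse_n | apply: le_trans dense_n].
move=> H HP; rewrite negb_or => /andP[sparse dense].
set e := adj (G :|: H); pose W := (C0 * l.+1 ^ 2)%N.
have e_sym : symmetric e by apply: adj_sym.
have e_conn : connected (G :|: H).
  move=> x y; apply: connect_sub (cG x y) => a b ab; apply: connect1.
  by apply: adj_mono ab; apply: subsetUl.
have nbr_gt0 v : (0 < nbr e v)%N by apply: connected_nbr_gt0.
have volJ : (vol e [set: 'I_n] < 2 ^ (2 * l.+1))%N.
  apply: (@leq_ltn_trans (n * n)%N); last by rewrite mulnC expnM; apply: leq_trans (_ : (n * n < 2 ^ l.+1 * 2 ^ l.+1)%N) _; [apply: ltn_mul | rewrite mulnn].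
  apply: (@leq_trans (\sum_(v in [set: 'I_n]) n)%N); last by rewrite sum_nat_const cardsT card_ord.
  by apply: leq_sum => v _; rewrite -[leqRHS](card_ord n) max_card.
have W_ge : (2 * ((3 * D.+1 * L) ^ 2 + 2 * (4 * k.+1 + 4) ^ 2 * (2 * l.+1)) <= W)%N.
  rewrite /W /C0 /L !expnMn; move: (D.+1 ^ 2)%N (m.+1 ^ 2)%N ((4 * k.+1 + 4) ^ 2)%N => a b K.
  have : (K * l.+1 <= K * l.+1 ^ 2)%N by rewrite leq_mul2l -mulnn leq_pmull ?orbT.
  move: (l.+1 ^ 2)%N l.+1 => l2 l1; clear; nia.
have W_gt0 : (0 < W)%N.
  by apply: leq_trans W_ge; rewrite !(muln_gt0, expn_gt0, addn_gt0) /= ?orbT.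
exists (264 * W)%N.
  rewrite -mulnA leq_mul2l /= -mulnA leq_mul2l; apply/orP; right.
  by rewrite (_ : 4 = 2 ^ 2)%N // -expnMn leq_sqr mul2n -addnn -addn1 leq_add2l.
have expan r (S : {set 'I_n}) : conn_in e r S -> (2 * vol e S <= vol e [set: 'I_n])%N ->
    (vol e S <= (4 * k.+1 + 4) * cut e S)%N \/ (vol e S <= 3 * D.+1 * L)%N.
  exact: (perturbed_expansion gG cG dG n1 (ltn0Sn k) Dc HP sparse dense).
move=> A x; exact: (lazy_walk_mixing R e_sym nbr_gt0 e_conn expan volJ W_ge W_gt0 A x).
Qed.
End WithHighProbability.

(** * Transfer to the real numbers of the standard library *)

Section StdlibReals.
Local Open Scope ring_scope.

Lemma IZR2E : IZR 2 = 2%:R :> R.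
Proof. by rewrite -INRE. Qed.

Lemma rsumE (I : finType) (P : pred I) (f : I -> R) : rsum P f = \sum_(i | P i) f i.
Proof. by []. Qed.

Section Walk.
Variables (n : nat) (E : {set {set 'I_n}}).
Notation e := (adj E).

Lemma lazyP_avg (f : 'I_n -> R) u : \sum_v lazyP E u v * f v = avg e f u.
Proof.
rewrite /lazyP (eq_bigr (fun v => (if u == v then f v / 2%:R else 0) +
   (if e u v then f v / (2%:R * (nbr e u)%:R) else 0))); last first.
  move=> v _; rewrite RplusE !RinvE RmultE INRE IZR2E mulrDl.
  by case: (u == v); case: (e u v); rewrite ?mul0r // ![_^-1 * _]mulrC.
rewrite big_split /= -!big_mkcond /=; congr (_ + _).
  by rewrite (big_pred1 u) // => v; rewrite eq_sym.
by rewrite -mulr_suml.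
Qed.

(** Evolving distributions is adjoint to averaging functions, so a bound for every starting vertex
    gives one for every starting distribution. *)
Lemma walk_dual t (x0 f : 'I_n -> R) :
  \sum_v walk E t x0 v * f v = \sum_u x0 u * iter t (avg e) f u.
Proof.
elim: t f => [|t IH] f //; rewrite iterSr -IH /=.
rewrite (eq_bigr (fun v => \sum_u walk E t x0 u * lazyP E u v * f v)); last first.
  by move=> v _; rewrite -mulr_suml.
rewrite exchange_big; apply: eq_bigr => u _ /=.
by rewrite -lazyP_avg mulr_sumr; apply: eq_bigr => v _; rewrite mulrA.
Qed.

Lemma rsum_stat (A : {set 'I_n}) : is_graph E ->
  rsum (mem A) (stat E) = (vol e A)%:R / (vol e [set: 'I_n])%:R.
Proof.
move=> gE; rewrite rsumE (eq_bigr (fun v => (nbr e v)%:R / (vol e [set: 'I_n])%:R)).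
  by rewrite -mulr_suml -(volE R e A).

move=> v _; rewrite /stat RdivE RmultE !INRE IZR2E -natrM (vol_adj gE).
have -> : E :&: inner [set: 'I_n] = E.
  by apply/setIidPl/subsetP => t tE; rewrite inE (subsetP gE) // subsetT.
have -> : E :&: across [set: 'I_n] = set0.
  by apply/setP => t; rewrite !inE subsetT andbF andbF.
by rewrite cards0 addn0.
Qed.

Lemma dTV_walk t (x0 : 'I_n -> R) : is_graph E -> is_distr x0 ->
  (forall (A : {set 'I_n}) x, `|iter t (avg e) (fun y => (y \in A)%:R) x
     - (vol e A)%:R / (vol e [set: 'I_n])%:R| <= 1 / 4 :> R) ->
  dTV_le (walk E t x0) (stat E) (/ 4)%R.
Proof.
move=> gE [x_ge0 x_sum] mix A; apply/RleP.
rewrite RabsE RminusE rsum_stat // rsumE.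
set pA := _ / _.
have -> : \sum_(i in A) walk E t x0 i = \sum_u x0 u * iter t (avg e) (fun y => (y \in A)%:R) u.
  rewrite -walk_dual big_mkcond; apply: eq_bigr => v _.
  by case: (v \in A); rewrite ?mulr1 ?mulr0.
have -> : pA = \sum_u x0 u * pA by rewrite -mulr_suml -[\sum_u _]rsumE x_sum mul1r.
rewrite -sumrB; apply: le_trans (ler_norm_sum _ _ _) _.
have -> : (/ 4)%R = \sum_u x0 u * (1 / 4).
  rewrite -mulr_suml -[\sum_u _]rsumE x_sum !mul1r RinvE; congr (_^-1).
  by rewrite -[RHS]INRE INR_IZR_INZ.
apply: ler_sum => u _; rewrite -mulrBr normrM ger0_norm; last by apply/RleP.
by apply: ler_wpM2l; [apply/RleP | apply: mix].
Qed.

End Walk.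

Lemma pw_edge_wt n (p : R) (S : {set {set 'I_n}}) : S \subset pairs n ->
  pw (@edge_wt R n p) S = p ^+ #|S| * (1 - p) ^+ (#|pairs n| - #|S|).
Proof.
move=> SP; have -> : (#|pairs n| - #|S|)%N = #|pairs n :\: S|.
  by rewrite cardsD (setIidPr SP).
rewrite -!prod_if_const -big_split; apply: eq_bigr => t _; rewrite in_setD /edge_wt.
case: (boolP (t \in S)) => [/(subsetP SP)->|_] /=; first by rewrite mulr1.
by rewrite mul1r; case: ifP; rewrite ?subr0.
Qed.

Lemma Gnp_probE n (p : R) (A : {set {set 'I_n}} -> Prop) :
  Gnp_prob p A = expect p (fun S => if excluded_middle_informative (A S) then 1 else 0).
Proof.
rewrite /Gnp_prob rsumE /expect big_mkcond; apply: eq_bigr => S _ /=.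
rewrite powersetE; case: (boolP (S \subset pairs n)) => SP; last by rewrite pw_edge_wt0 // mul0r.
rewrite pw_edge_wt //; case: (excluded_middle_informative (A S)) => h /=; last by rewrite mulr0.
by rewrite mulr1 !RpowE.
Qed.

End StdlibReals.

Open Scope R_scope.

Lemma trunc_log_le_ln n : (0 < n)%N -> INR (trunc_log 2 n) <= 2 * ln (INR n).
Proof.
move=> n0; have h := ln_lt_2; set l := trunc_log 2 n.
have l0 : 0 <= INR l by apply: pos_INR.
have : INR l * ln 2 <= ln (INR n).
  rewrite -ln_pow; last by apply: Rlt_0_2.
  have le_n : 2 ^ l <= INR n.
    by apply/RleP; rewrite RpowE INRE IZR2E -natrX ler_nat trunc_logP.
  have pos : 0 < 2 ^ l by apply: pow_lt; apply: Rlt_0_2.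
  by case: le_n => [lt_n|->]; [left; apply: ln_increasing | right].
have : INR l * / 2 <= INR l * ln 2 by apply: Rmult_le_compat_l => //; left.
by move=> h1 h2; Lra.lra.
Qed.

Theorem theorem5 :
  forall (D : nat) (eps : R), (0 < D)%N -> (0 < eps) ->
  exists M : R,
    forall Gs : forall n : nat, {set {set 'I_n}},
      (forall n, is_graph (Gs n) /\ connected (Gs n) /\ degenerate D (Gs n)) ->
      Un_cv (fun n => Gnp_prob (eps / INR n)
                        (fun S => Tmix_le (Gs n :|: S) (M * (ln (INR n)) ^ 2)))
            1.
Proof.
move=> D eps _ /RltP eps0; have [C mix] := perturbed_mixing D eps0.
(* The 4 is the square of the 2 in [trunc_log_le_ln], which turns the binary logarithm into the
   natural one. *)
exists (INR C * 4) => Gs GsP e /RltP e0.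
(* Three thresholds: [n >= 2], [eps <= n] so that [eps / n] is a probability, and [2 / n < e] for
   the failure bound. *)
pose N := (maxn 2 (maxn (Num.truncn eps).+1 (Num.truncn (2%:R / e)%R).+1))%N.
exists N => n /ssrnat.leP; rewrite !geq_max => /and3P[n1 epsn en].
have [gG [cG dG]] := GsP n.
have n0 : (0 < n)%N by apply: ltnW.
have epsn' : (eps <= n%:R)%R by apply/ltW/(lt_le_trans (real_truncnS_gt (num_real eps))); rewrite ler_nat.
have [bad bad_small good] := mix n (Gs n) n1 epsn' gG cG dG.
apply/RltP; rewrite Gnp_probE INRE RdivE RdistE.
set P := expect _ _; have nR : (0 < n%:R :> R)%R by rewrite ltr0n.
have p01 : (0 <= eps / n%:R <= 1)%R.
  by rewrite divr_ge0 ?(ltW eps0) //= ler_pdivrMr // mul1r.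
have expect1 : expect (eps / n%:R)%R (fun _ : {set {set 'I_n}} => 1%R : R) = 1%R.
  by apply: etrans (sum_pw (@edge_wt R n (eps / n%:R)%R)); apply: eq_bigr => H _; rewrite mulr1.
have P_le1 : (P <= 1)%R.
  by rewrite -[leRHS]expect1; apply: expect_le => // H _; case: (excluded_middle_informative _).
have P_ge : (1 <= P + expect (eps / n%:R) (fun H : {set {set 'I_n}} => (bad H)%:R))%R.
  rewrite -[leLHS]expect1 -expectD; apply: expect_le => // H HP.
  case: (excluded_middle_informative _) => [mixed|notmix] /=; first by rewrite lerDl.
  rewrite add0r; case: (boolP (bad H)) => // gH; case: notmix => x0 x0P.
  have [T T_le close] := good H HP gH.
  exists T; split; last first.
    by apply: dTV_walk => //; rewrite /is_graph subUset; apply/andP.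
  have := trunc_log_le_ln n0; rewrite -INRE; set l := trunc_log 2 n in T_le *.
  move=> l_le; apply: Rle_trans (_ : INR C * (INR l) ^ 2 <= _).
    apply/RleP; rewrite RmultE RpowE !INRE -natrX -natrM ler_nat; exact: T_le.
  rewrite Rmult_assoc; apply: Rmult_le_compat_l; first exact: pos_INR.
  have l0 := pos_INR l; move: (ln _) l_le => y l_le.
  have : INR l * INR l <= (2 * y) * (2 * y) by apply: Rmult_le_compat.
  by rewrite /= ; Lra.lra.
have e_large : (2 / n%:R < e)%R.
  rewrite ltr_pdivrMr // mulrC -ltr_pdivrMr //.
  by apply: lt_le_trans (real_truncnS_gt (num_real _)) _; rewrite ler_nat.
rewrite ler0_norm ?subr_le0 // opprB.
apply: le_lt_trans e_large; apply: le_trans bad_small.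
by rewrite lerBlDl.
Qed.
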